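(* Let $\phi:\Sigma^n\to\mathbb{R}\times_f\mathbb{R}^n$ be a rotational hypersurface with angle function $|\theta|<1$, with profile parameter $s$ and $\sigma(s)=f(\zeta(s))\beta(s)$, and let $h=\pi_{\mathbb{R}}\circ\phi$. Then $\Sigma^n$ has a gradient Einstein-type structure with potential function $h$ (with data $\alpha>0$, $u$, $\mu$, $\lambda$) if and only if the following system of equations is satisfied: $$\lambda=-(n-1)(1-\theta^2)\frac{f''(h)}{f(h)}-(n-1)\theta\frac{\sqrt{1-\theta^2}}{\sigma}(\log f)'(h)+\left[(n-1)\left(\theta(\log f)'(h)-\frac{\sqrt{1-\theta^2}}{\sigma}\right)-\theta\right]\frac{\theta'}{\sqrt{1-\theta^2}}-\alpha\frac{|\tau_g u|^2}{1-\theta^2}-\mu(1-\theta^2),$$ for every $i\in\{1,\dots,n-1\}$ $$\lambda-\frac{f'(h)}{f(h)}-\theta\left(\frac{\sqrt{1-\theta^2}}{\sigma}-\frac{f'(h)}{f(h)}\theta\right)=(n-2)\left(\frac{\sqrt{1-\theta^2}}{\sigma}-\frac{f'(h)}{f(h)}\theta\right)^2-(1-\theta^2)(\log f)''(h)+(\theta^2-(n-1))\big((\log f)'(h)\big)^2-\frac{f'(h)}{f(h)}\theta\frac{\sqrt{1-\theta^2}}{\sigma}-\frac{\theta'}{\sigma}+\frac{\theta'}{\sqrt{1-\theta^2}}\frac{f'(h)}{f(h)}\theta-\alpha\frac{du(\phi_{v_i})^2}{\sigma^2},$$ $$du(\phi_s)\,du(\phi_{v_i})=0\ \ \forall i,\qquad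 du(\phi_{v_i})\,du(\phi_{v_j})=0\ \ \forall i\ne j,$$ $$\tau_g u=\sqrt{1-\theta^2}\,du(\phi_s).$$
   Context: A gradient Einstein-type structure on $(\Sigma^n,g)$ with potential $h$ is given by a real number $\alpha>0$, a smooth map $u:(\Sigma^n,g)\to(N^p,g')$ into a Riemannian manifold with tension field $\tau_g u=\mathrm{trace}\,\nabla(du)$, and smooth functions $\mu,\lambda$ on $\Sigma$ such that $Ric_g-\alpha u^*g'+\mathrm{Hess}\,h-\mu\,dh\otimes dh=\lambda g$ and $\tau_g u=du(\nabla h)$. The products $du(X)\,du(Y)$ denote $g'(du(X),du(Y))$, and $du(X)^2=g'(du(X),du(X))$. $\mathbb{R}\times_f\mathbb{R}^n$ is $\mathbb{R}\times\mathbb{R}^n$ with metric $\langle\,,\rangle=dt^2+f(t)^2g_{\mathbb{R}^n}$, $f:\mathbb{R}\to(0,\infty)$ smooth. A rotational hypersurface (invariant under $O(n)$ acting on $\mathbb{R}^n$) with axis $\eta_1=\partial_t$ is parametrized by $$\phi(s,v_1,\dots,v_{n-1})=\zeta(s)\eta_1+\beta(s)X(v_1,\dots,v_{n-1}),\qquad s\in(t_0,t_1),$$ where $X$ is an orthogonal parametrization of the unit sphere $\mathbb{S}^{n-1}\subset\mathbb{R}^n$ and the profile curve $s\mapsto(\zeta(s),0,\dots,0,\beta(s))$ is parametrized by arc length: $\zeta'^2+f(\zeta)^2\beta'^2=1$, $\beta>0$. The unit normal is $\nu=f(\zeta)\beta'\,\eta_1-\frac{\zeta'}{f(\zeta)}X$,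 the angle function is $\theta(s)=\langle\partial_t,\nu\rangle=f(\zeta(s))\beta'(s)$, and $\zeta'=\sqrt{1-\theta^2}$; so $h=\zeta(s)=\int^s\sqrt{1-\theta^2}\,ds$. The induced metric is $g=ds^2+\sigma(s)^2dv^2$, where $dv^2$ is the metric of the unit sphere $\mathbb{S}^{n-1}$ and $\sigma(s)=f(\zeta(s))\beta(s)$. Here $\phi_s=\zeta'\eta_1+\beta'X$, and $\phi_{v_1},\dots,\phi_{v_{n-1}}$ are the mutually orthogonal directions $\phi_{v_i}=\beta X_{v_i}$ tangent to the spherical factor, the $X_{v_i}$ being understood as unit tangent vectors of $\mathbb{S}^{n-1}$, so that $g(\phi_s,\phi_s)=1$, $g(\phi_s,\phi_{v_i})=0$, and $g(\phi_{v_i},\phi_{v_j})=\sigma^2\delta_{ij}$. A prime on $\theta$ denotes $d/ds$; primes on $f$ and $\log f$ denote derivatives in $t$. *)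

(* Defs.v *)
From mathcomp Require Import all_boot all_order all_algebra.
From mathcomp Require Import all_classical all_reals all_analysis.
Set Implicit Arguments.
Unset Strict Implicit.
Unset Printing Implicit Defensive.
Import Order.TTheory GRing.Theory Num.Theory numFieldNormedType.Exports.
Local Open Scope classical_set_scope.
Local Open Scope ring_scope.

Section smoothness.
Context {R : realType}.

Definition partial n (i : 'I_n) (F : 'rV[R]_n -> R) : 'rV[R]_n -> R :=
  'D_(delta_mx 0 i) F.

(* Differentiability of every iterated partial derivative makes each of them
   continuous, so on an open U this is C^oo. *)
Definition smooth_on n (U : set 'rV[R]_n) (F : 'rV[R]_n -> R) : Prop :=
  forall (s : seq 'I_n) q, U q -> differentiable (foldr (@partial n) F s) q.

Definition smooth_map_on n p (U : set 'rV[R]_n) (F : 'rV[R]_n -> 'rV[R]_p) :=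
  forall j, smooth_on U (fun q => F q 0 j).

Definition smooth_on_line (A : set R) (F : R -> R) : Prop :=
  forall k t, A t -> derivable (derive1n k F) t 1.

End smoothness.

(* Classical tensor calculus in one coordinate chart.  Tangent vectors are row
   vectors of components and G q is the matrix of the metric at the point of
   coordinates q; with the row convention dF(v) = v *m 'J F q. *)
Section local_geometry.
Context {R : realType}.

Definition metric_dot n (G : 'M[R]_n) (v w : 'rV[R]_n) : R :=
  (v *m G *m w^T) 0 0.

Definition pullback n p (G : 'rV[R]_p -> 'M[R]_p) (F : 'rV[R]_n -> 'rV[R]_p)
    (q : 'rV[R]_n) : 'M[R]_n :=
  'J F q *m G (F q) *m ('J F q)^T.

Section chart.
Variables (n : nat) (G : 'rV[R]_n -> 'M[R]_n).

(* The Christoffel symbol of the Levi-Civita connection with upper index k. *)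
Definition christoffel (k i j : 'I_n) (q : 'rV[R]_n) : R :=
  2^-1 * \sum_l invmx (G q) k l *
    (partial i (fun x => G x j l) q + partial j (fun x => G x i l) q
     - partial l (fun x => G x i j) q).

(* Sign: the Ricci tensor of a round sphere is positive. *)
Definition ricci (q : 'rV[R]_n) : 'M[R]_n :=
  \matrix_(i, j)
   ((\sum_k (partial k (christoffel k i j) q
             - partial j (christoffel k i k) q))
    + \sum_k \sum_l (christoffel k k l q * christoffel l i j q
                     - christoffel k j l q * christoffel l i k q)).

Definition differential (F : 'rV[R]_n -> R) (q : 'rV[R]_n) : 'rV[R]_n :=
  \row_i partial i F q.

Definition hessian (F : 'rV[R]_n -> R) (q : 'rV[R]_n) : 'M[R]_n :=
  \matrix_(i, j) (partial i (partial j F) q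
                  - \sum_k christoffel k i j q * partial k F q).

Definition gradient (F : 'rV[R]_n -> R) (q : 'rV[R]_n) : 'rV[R]_n :=
  differential F q *m invmx (G q).

End chart.

(* trace_G (nabla dF), where nabla is induced by the Levi-Civita connections of
   the metric G of the source and of the metric G' of the target. *)
Definition tension n p (G : 'rV[R]_n -> 'M[R]_n) (G' : 'rV[R]_p -> 'M[R]_p)
    (F : 'rV[R]_n -> 'rV[R]_p) (q : 'rV[R]_n) : 'rV[R]_p :=
  let Fc (c : 'I_p) := fun x => F x 0 c in
  \row_c \sum_i \sum_j invmx (G q) i j *
    (partial i (partial j (Fc c)) q
     - (\sum_k christoffel G k i j q * partial k (Fc c) q)
     + \sum_a \sum_b christoffel G' c a b (F q)
                     * partial i (Fc a) q * partial j (Fc b) q).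

End local_geometry.

(* Riemannian manifolds of dimension n given by an atlas of parametrizations of
   open subsets of R^n.  The topology is the one for which the parametrizations
   are homeomorphisms onto open subsets; chart_separated and chart_countable say
   that it is Hausdorff and second countable.  The atlas need not be maximal. *)
Record rmanifold (R : realType) (n : nat) := RManifold {
  point :> Type;
  chart : Type;
  dom : chart -> set 'rV[R]_n;
  param : chart -> 'rV[R]_n -> point;
  coord : chart -> point -> 'rV[R]_n;
  metric : chart -> 'rV[R]_n -> 'M[R]_n;
  overlap := fun a b : chart =>
    [set q | dom a q /\ (param b @` dom b) (param a q)];
  transition := fun (a b : chart) q => coord b (param a q);
  dom_open : forall a, open (dom a);
  paramK : forall a q, dom a q -> coord a (param a q) = q;
  chart_cover : forall x, exists a, (param a @` dom a) x;
  overlap_open : forall a b, open (overlap a b);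
  transition_smooth :
    forall a b, smooth_map_on (overlap a b) (transition a b);
  chart_separated : forall x y, x <> y -> exists a b A B,
    [/\ open A /\ A `<=` dom a, open B /\ B `<=` dom b,
        (param a @` A) x, (param b @` B) y &
        (param a @` A) `&` (param b @` B) = set0];
  chart_countable : exists2 J : set chart, countable J &
    forall x, exists2 a, J a & (param a @` dom a) x;
  metric_smooth : forall a i j, smooth_on (dom a) (fun q => metric a q i j);
  metric_sym : forall a q, dom a q -> (metric a q)^T = metric a q;
  metric_pos : forall a q, dom a q ->
    forall v, v != 0 -> 0 < metric_dot (metric a q) v v;
  metric_compat : forall a b q, overlap a b q ->
    metric a q = pullback (metric b) (transition a b) q
}.

Section manifold_maps.
Context {R : realType} {n p : nat}.
Variables (M : rmanifold R n) (N : rmanifold R p).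

Definition chart_image (a : chart M) : set M := param a @` dom a.

Definition read (F : M -> R) (a : chart M) : 'rV[R]_n -> R :=
  fun q => F (param a q).

Definition smooth_fun (F : M -> R) : Prop :=
  forall a, smooth_on (dom a) (read F a).

Definition local_rep (u : M -> N) (a : chart M) (b : chart N) :
    'rV[R]_n -> 'rV[R]_p :=
  fun q => coord b (u (param a q)).

End manifold_maps.

Section manifold_structures.
Context {R : realType} {n p : nat}.
Variables (M : rmanifold R n) (N : rmanifold R p).

Definition rep_dom (u : M -> N) (a : chart M) (b : chart N) : set 'rV[R]_n :=
  [set q | dom a q /\ chart_image b (u (param a q))].

(* Openness of rep_dom is the continuity of u. *)
Definition smooth_map (u : M -> N) : Prop :=
  forall a b, open (rep_dom u a b) /\
              smooth_map_on (rep_dom u a b) (local_rep u a b).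

(* The two tensorial equations are required in the coordinates of all charts. *)
Definition einstein_type (h : M -> R) (alpha : R) (u : M -> N)
    (mu lambda : M -> R) : Prop :=
  [/\ 0 < alpha, smooth_fun h, smooth_map u, smooth_fun mu & smooth_fun lambda]
  /\ forall (a : chart M) (b : chart N) (q : 'rV[R]_n), rep_dom u a b q ->
     let x := param a q in
     let dh := differential (read h a) q in
     let U := local_rep u a b in
     ricci (metric a) q - alpha *: pullback (metric b) U q
       + hessian (metric a) (read h a) q - mu x *: (dh^T *m dh)
       = lambda x *: metric a q
     /\ tension (metric a) (metric b) U q
        = gradient (metric a) (read h a) q *m 'J U q.

End manifold_structures.

Section rotational.
Context {R : realType}.

Definition eucl_dot k (x y : 'rV[R]_k) : R := \sum_i x 0 i * y 0 i.

(* The ambient space R x R^k is 'rV_k.+1, the factor R being coordinate 0. *)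
Definition ambient k (t : R) (x : 'rV[R]_k) : 'rV[R]_k.+1 :=
  \row_j if unlift ord0 j is Some i then x 0 i else t.

(* dt^2 + f(t)^2 g_{R^k} *)
Definition warped_metric k (f : R -> R) (y : 'rV[R]_k.+1) : 'M[R]_k.+1 :=
  diag_mx (ambient 1 (const_mx (f (y 0 0) ^+ 2))).

Definition profile_point k (zeta beta : R -> R) (s : R) (x : 'rV[R]_k) :=
  ambient (zeta s) (beta s *: x).

(* nu = f(zeta) beta' eta_1 - (zeta' / f(zeta)) X *)
Definition unit_normal k (f zeta beta : R -> R) (s : R) (x : 'rV[R]_k) :=
  ambient (f (zeta s) * derive1 beta s) (- (derive1 zeta s / f (zeta s)) *: x).

Definition angle (f zeta beta : R -> R) (s : R) : R :=
  f (zeta s) * derive1 beta s.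

Lemma angleE k (f zeta beta : R -> R) (s : R) (x : 'rV[R]_k) :
  metric_dot (warped_metric f (profile_point zeta beta s x))
    (ambient 1 0) (unit_normal f zeta beta s x) = angle f zeta beta s.
Proof.
rewrite /metric_dot /warped_metric mul_mx_diag mxE big_ord_recl big1 => [|i _].
  by rewrite !mxE unlift_none !mul1r addr0.
by rewrite !mxE liftK !mxE !mul0r.
Qed.

Definition parallel_radius (f zeta beta : R -> R) (s : R) : R := f (zeta s) * beta s.

Definition tpartial k l (i : 'I_k) (X : 'rV[R]_k -> 'rV[R]_l) :
    'rV[R]_k -> 'rV[R]_l := 'D_(delta_mx 0 i) X.

(* Parametrizations of an open part of the unit sphere of R^l whose coordinate
   vectors are nonzero and pairwise orthogonal. *)
Definition orthogonal_sphere_param k l (V : set 'rV[R]_k)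
    (X : 'rV[R]_k -> 'rV[R]_l) : Prop :=
  [/\ open V, smooth_map_on V X, {in V &, injective X} &
   forall v, V v ->
     [/\ eucl_dot (X v) (X v) = 1,
         forall i, tpartial i X v != 0 &
         forall i j, i != j -> eucl_dot (tpartial i X v) (tpartial j X v) = 0]].

(* In a chart of the hypersurface the coordinates are q = (s, v). *)
Definition spart m (q : 'rV[R]_m.+1) : R := q 0 0.
Definition vpart m (q : 'rV[R]_m.+1) : 'rV[R]_m := \row_i q 0 (lift ord0 i).

Definition height (T : Type) k (phi : T -> 'rV[R]_k.+1) : T -> R :=
  fun x => phi x 0 0.

(* The coordinate vector field phi_s. *)
Definition frame_s m : 'rV[R]_m.+1 := delta_mx 0 0.

(* phi_{v_i} = beta X_{v_i} with X_{v_i} a unit vector: the coordinate vector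
   d/dv_i divided by the Euclidean norm of dX/dv_i. *)
Definition frame_v m (X : 'rV[R]_m -> 'rV[R]_m.+1) (q : 'rV[R]_m.+1) (i : 'I_m) :
    'rV[R]_m.+1 :=
  let Xi := tpartial i X (vpart q) in
  (Num.sqrt (eucl_dot Xi Xi))^-1 *: delta_mx 0 (lift ord0 i).

(* phi : S -> R x_f R^n, n = m + 1, is the rotational hypersurface with profile
   curve (zeta, beta) on (t0, t1).  Its charts are (s, v) |-> phi(s, v), one
   for each member X a of a family of orthogonal parametrizations covering the
   sphere, and its metric is induced by phi. *)
Record rotational_hypersurface m (S : rmanifold R m.+1) (f : R -> R)
    (t0 t1 : \bar R) (zeta beta : R -> R) (phi : S -> 'rV[R]_m.+2)
    (V : chart S -> set 'rV[R]_m) (X : chart S -> 'rV[R]_m -> 'rV[R]_m.+1)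
    : Prop := {
  rot_interval : (t0 < t1)%E;
  rot_warp_smooth : smooth_on_line setT f;
  rot_warp_pos : forall t, 0 < f t;
  rot_zeta_smooth :
    smooth_on_line [set s | (t0 < s%:E)%E /\ (s%:E < t1)%E] zeta;
  rot_beta_smooth :
    smooth_on_line [set s | (t0 < s%:E)%E /\ (s%:E < t1)%E] beta;
  rot_beta_pos : forall s, (t0 < s%:E)%E -> (s%:E < t1)%E -> 0 < beta s;
  rot_arc_length : forall s, (t0 < s%:E)%E -> (s%:E < t1)%E ->
    derive1 zeta s ^+ 2 + f (zeta s) ^+ 2 * derive1 beta s ^+ 2 = 1;
  rot_zeta_deriv : forall s, (t0 < s%:E)%E -> (s%:E < t1)%E ->
    derive1 zeta s = Num.sqrt (1 - angle f zeta beta s ^+ 2);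
  rot_inj : injective phi;
  rot_image : range phi = [set y | exists s x,
    [/\ (t0 < s%:E)%E, (s%:E < t1)%E, eucl_dot x x = 1 &
        y = profile_point zeta beta s x]];
  rot_sphere_param : forall a, orthogonal_sphere_param (V a) (X a);
  rot_dom : forall a, dom a =
    [set q | [/\ (t0 < (spart q)%:E)%E, ((spart q)%:E < t1)%E & V a (vpart q)]];
  rot_param : forall a q, dom a q ->
    phi (param a q) = profile_point zeta beta (spart q) (X a (vpart q));
  rot_metric : forall a q, dom a q ->
    metric a q = pullback (warped_metric f) (fun q' => phi (param a q')) q
}.

End rotational.

(* Main.v *)
Require Import Defs.
From mathcomp Require Import all_boot all_order all_algebra.
From mathcomp Require Import all_classical all_reals all_analysis.
From mathcomp Require Import ring.
Set Implicit Arguments.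
Unset Strict Implicit.
Unset Printing Implicit Defensive.
Import Order.TTheory GRing.Theory Num.Theory numFieldNormedType.Exports.
Local Open Scope classical_set_scope.
Local Open Scope ring_scope.

(** In a chart the induced metric is ds^2 + sigma(s)^2 e, where e is the metric
  of the unit sphere in the coordinates v, and h = zeta(s).  The Christoffel
  symbols of a warped product reduce Ric and Hess h to sigma, zeta and Ric_e, and
  Ric_e = (n - 2) e by the Gauss formula: the second derivatives of the sphere
  parametrization X are expanded in the orthogonal basis (X, X_1, ..., X_(n-1)).
  Ric, Hess h, dh (x) dh and g are then all diagonal in the orthogonal frame, so
  the tensor equation splits into the radial equation, the spherical equations
  and the vanishing of the off-diagonal part of u^* g'.  Inserting
  sigma' = (log f)' zeta' sigma + theta and zeta'' = - theta theta' / zeta' gives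
  the two scalar equations, and tau = du(grad h) = zeta' du(phi_s) lets
  du(phi_s)^2 be written as |tau|^2 / (1 - theta^2). *)

(** * Derivatives *)

(** Because [ricci] is the coordinate expression in Christoffel symbols, the Gauss equation of the
    sphere emerges from a computation: differentiating the symbols produces third derivatives of X,
    which cancel by Young's theorem, and quadratic terms, which cancel up to products of metric
    coefficients. All formulas hold only on open chart domains while the functions are total, so
    each one is differentiated through equality near the point. The equivalence is pointwise: at
    fixed charts and coordinates each component of the tensor equation is equivalent to one scalar
    equation. The assumption on the angle gives w = zeta' > 0, so that division by w is legitimate.
    After division by sigma^2 e the shape of the spherical equation comes from two identities. The
    Hessian part is sigma' w / sigma = f'/f + theta (w/sigma - (f'/f) theta), which accounts for the
    terms beside lambda; and (1 - sigma'^2) / sigma^2 = (w/sigma - (f'/f) theta)^2 - (f'/f)^2, which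
    accounts for the square. *)

Section derivative_calculus.
Context {R : realType}.

Lemma near_open (T : topologicalType) (U : set T) (P : T -> Prop) (q : T) :
  open U -> U q -> (forall x, U x -> P x) -> \near q, P q.
Proof.
move=> oU Uq UP; have := open_nbhs_nbhs (conj oU Uq).
by apply: filterS => x; exact: UP.
Qed.

(** Locality of differentiability: the little-o expansion of [f] at [a] is also one of [g], and
    uniqueness of the differential identifies ['d g a] with ['d f a]. *)
Lemma near_eq_differentiable (V W : normedModType R) (f g : V -> W) (a : V) :
  (\near a, f a = g a) -> differentiable f a -> differentiable g a.
Proof.
move=> fg df.
have /eqaddoP dfo := diff_locally df.
have dfc : continuous ('d f a) by exact: diff_continuous.
have go : g \o shift a = cst (g a) + 'd f a +o_ 0 id.
  apply/eqaddoP => e e0; have := dfo e e0; apply: filter_app.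
  have : \forall h \near 0, f (h + a) = g (h + a).
    by move: fg; rewrite (near_shift 0 a) /= subr0.
  apply: filterS => x /= fgx.
  rewrite -[(g \o _ - _) x]/(g (x + a) - (g a + (_ x))).
  rewrite -[(f \o _ - _) x]/(f (x + a) - (f a + (_ x))).
  by rewrite -fgx (nbhs_singleton fg).
by apply/diff_locallyP; rewrite (diff_unique dfc go).
Qed.

(** The difference quotients of the two sides are the same function of [h]. Only the values of [L]
    on the line through [x] matter, so this chain rule works with directional derivatives alone. *)
Lemma derive_comp_affine (V V' W : normedModType R) (L : V -> V') (F : V' -> W)
    (x v : V) (w : V') : (forall h : R, L (h *: v + x) = h *: w + L x) ->
  'D_v (F \o L) x = 'D_w F (L x).
Proof. by move=> Lw; rewrite /derive; under eq_fun do rewrite /= Lw. Qed.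

Lemma is_derive_comp_affine (V V' W : normedModType R) (L : V -> V')
    (F : V' -> W) (x v : V) (w : V') (dF : W) :
  (forall h : R, L (h *: v + x) = h *: w + L x) ->
  is_derive (L x) w F dF -> is_derive x v (F \o L) dF.
Proof.
move=> Lw [dF1 dF2]; split; last by rewrite (derive_comp_affine _ Lw).
rewrite /derivable; under [X in cvg (X @ _)]eq_fun do rewrite /= Lw.
exact: dF1.
Qed.

Lemma differentiable_rV (V : normedModType R) n (F : V -> 'rV[R]_n) x :
  (forall j, differentiable (fun y => F y 0 j) x) -> differentiable F x.
Proof.
move=> dF.
have -> : F = \sum_j ((fun y => F y 0 j *: delta_mx 0 j) : V -> 'rV[R]_n).
  apply/funext => y; rewrite fct_sumE [LHS]row_sum_delta.
  by [].
by apply: differentiable_sum => j; exact: differentiableZl.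
Qed.

Lemma jacobianE n k (F : 'rV[R]_n -> 'rV[R]_k) q i j :
  differentiable F q -> ('J F q) i j = partial i (fun x => F x 0 j) q.
Proof.
move=> dF; rewrite /partial.
have := derive_mx (@diff_derivable _ _ _ _ _ (delta_mx 0 i) dF).
rewrite deriveEjacobian // -rowE => /rowP/(_ j).
by rewrite !mxE.
Qed.

Section open_set.
Variables (n : nat) (U : set 'rV[R]_n).
Hypothesis oU : open U.

Lemma eq_partial (F G : 'rV[R]_n -> R) : (forall q, U q -> F q = G q) ->
  forall i q, U q -> partial i F q = partial i G q.
Proof. by move=> FG i q Uq; apply: near_eq_derive; exact: near_open Uq FG. Qed.

Lemma eq_partials (F G : 'rV[R]_n -> R) : (forall q, U q -> F q = G q) ->
  forall s q, U q -> foldr (@partial R n) F s q = foldr (@partial R n) G s q.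
Proof.
by move=> FG; elim => [|i s IH] //= q Uq; exact: eq_partial.
Qed.

Lemma smooth_on_eq (F G : 'rV[R]_n -> R) : (forall q, U q -> F q = G q) ->
  smooth_on U F -> smooth_on U G.
Proof.
move=> FG sF s q Uq; apply: near_eq_differentiable (sF s q Uq).
by apply: near_open Uq _ => // x Ux; exact: eq_partials.
Qed.

Lemma smooth_on_partial (F : 'rV[R]_n -> R) i :
  smooth_on U F -> smooth_on U (partial i F).
Proof. by move=> sF s q Uq; rewrite -foldr_rcons; exact: sF. Qed.

End open_set.
End derivative_calculus.

(** * Young's theorem *)

Section symmetry_of_second_derivatives.
Context {R : realType}.

(** Mean value theorem twice: in direction [u] for the difference of [F] along the parallel segments
    issuing from [h *: v + q] and from [q], then in direction [v] for ['D_u F]. *)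
Lemma second_difference (V : normedModType R) (F : V -> R) (U : set V) (q u v : V) (h : R) :
  0 < h ->
  (forall a b, 0 <= a <= h -> 0 <= b <= h -> U (a *: u + (b *: v + q))) ->
  (forall x, U x -> derivable F x u) ->
  (forall x, U x -> derivable ('D_u F) x v) ->
  exists a b, [/\ 0 <= a <= h, 0 <= b <= h &
    F (h *: u + (h *: v + q)) - F (h *: v + q) - (F (h *: u + q) - F q)
    = 'D_v ('D_u F) (a *: u + (b *: v + q)) * h ^+ 2].
Proof.
move=> h0 HU dF d2F.
have hh : 0 <= h <= h by rewrite lexx ltW.
have h00 : (0 : R) <= 0 <= h by rewrite lexx ltW.
pose L y t := t *: u + y.
have dL y t : U (L y t) -> is_derive t (1 : R) (F \o L y) ('D_u F (L y t)).
  move=> UL; apply: (@is_derive_comp_affine _ _ _ _ _ _ _ _ u).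
    by move=> k; rewrite /L [_%:A]mulr1 scalerDl addrA.
  exact/derivableP/dF.
pose phi := (F \o L (h *: v + q)) - (F \o L q).
pose dphi t := 'D_u F (L (h *: v + q) t) - 'D_u F (L q t).
have U0 t : 0 <= t <= h -> U (L q t).
  by move=> th; have := HU t 0 th h00; rewrite scale0r add0r.
have dphiP t : 0 <= t <= h -> is_derive t 1 phi (dphi t).
  by move=> th; apply: is_deriveB; apply: dL; [exact: HU|exact: U0].
have [||a ah] := @MVT _ phi dphi 0 h h0.
- by move=> t; rewrite in_itv /= => /andP[t0 th]; apply: dphiP; rewrite !ltW.
- apply: derivable_within_continuous => t; rewrite in_itv /= => th.
  exact: (dphiP _ th).(ex_derive).
move: ah; rewrite in_itv /= => /andP[/ltW a0 /ltW ah].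
have {a0}ah : 0 <= a <= h by rewrite a0.
rewrite subr0 => phiE.
pose M t := a *: u + (t *: v + q).
pose psi := 'D_u F \o M.
have psiP t : 0 <= t <= h -> is_derive t 1 psi ('D_v ('D_u F) (M t)).
  move=> th; apply: (@is_derive_comp_affine _ _ _ _ _ _ _ _ v).
    by move=> k; rewrite /M [_%:A]mulr1 scalerDl -(addrA _ _ q) [LHS]addrCA.
  exact/derivableP/d2F/HU.
have [||b bh] := @MVT _ psi (fun t => 'D_v ('D_u F) (M t)) 0 h h0.
- by move=> t; rewrite in_itv /= => /andP[t0 th]; apply: psiP; rewrite !ltW.
- apply: derivable_within_continuous => t; rewrite in_itv /= => th.
  exact: (psiP _ th).(ex_derive).
move: bh; rewrite in_itv /= => /andP[/ltW b0 /ltW bh].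
rewrite subr0 => psiE.
exists a, b; split=> //; first by rewrite b0.
rewrite expr2 mulrA -psiE.
move: phiE; rewrite /phi /dphi /psi /L /M /= !fctE /= !scale0r !add0r => <-.
by ring.
Qed.

(** The second difference over a parallelogram is symmetric in [u] and [v], so each mixed derivative
    takes the same value at some point of a small parallelogram. If the values at [q] differed,
    continuity would keep both mixed derivatives within half of that gap near [q], a
    contradiction. *)
Lemma derive_symmetric (V : normedModType R) (F : V -> R) (U : set V) (q u v : V) :
  open U -> U q ->
  (forall x, U x -> derivable F x u) -> (forall x, U x -> derivable F x v) ->
  (forall x, U x -> derivable ('D_u F) x v) ->
  (forall x, U x -> derivable ('D_v F) x u) ->
  {for q, continuous ('D_v ('D_u F))} -> {for q, continuous ('D_u ('D_v F))} ->
  'D_v ('D_u F) q = 'D_u ('D_v F) q.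
Proof.
move=> oU Uq du dv duv dvu cuv cvu; apply/eqP/negPn/negP => neq.
pose A := 'D_v ('D_u F) q; pose B := 'D_u ('D_v F) q.
have e0 : 0 < `|A - B| / 2 by rewrite divr_gt0 // normr_gt0 subr_eq0.
have : \near q, [/\ U q, `|A - 'D_v ('D_u F) q| < `|A - B| / 2 &
                    `|B - 'D_u ('D_v F) q| < `|A - B| / 2].
  have nU : nbhs q U := open_nbhs_nbhs (conj oU Uq).
  have nuv : \near q, `|A - 'D_v ('D_u F) q| < `|A - B| / 2.
    exact: (cvgrPdist_lt _ _).1 cuv _ e0.
  have nvu : \near q, `|B - 'D_u ('D_v F) q| < `|A - B| / 2.
    exact: (cvgrPdist_lt _ _).1 cvu _ e0.
  by apply: filterS (filterI nU (filterI nuv nvu)) => x [? []]; split.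
move=> /nbhs_ballP[d /= d0]; rewrite -ball_normE => dP.
have [h h0 hd] : exists2 h : R, 0 < h & h * `|u| + h * `|v| < d.
  have k0 : 0 < `|u| + `|v| + 1 by rewrite ltr_wpDl // addr_ge0.
  exists (d / 2 / (`|u| + `|v| + 1)); first by rewrite !divr_gt0.
  rewrite -mulrDr mulrAC ltr_pdivrMr // -mulrA ltr_pM2l //.
  by rewrite mulrC ltr_pdivrMr // mulr_natr mulr2n ltr_wpDl // ltrDl.
have near_q a b : 0 <= a <= h -> 0 <= b <= h -> `|q - (a *: u + (b *: v + q))| < d.
  move=> /andP[a0 ah] /andP[b0 bh].
  rewrite addrA [_ + q]addrC opprD addrA subrr sub0r normrN.
  rewrite (le_lt_trans (ler_normD _ _)) // !normrZ !ger0_norm //.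
  by apply: le_lt_trans hd; rewrite lerD // ler_wpM2r.
have inU a b : 0 <= a <= h -> 0 <= b <= h -> U (a *: u + (b *: v + q)).
  by move=> ah bh; have [] := dP _ (near_q a b ah bh).
have inU' a b : 0 <= a <= h -> 0 <= b <= h -> U (a *: v + (b *: u + q)).
  by move=> ah bh; rewrite addrCA; apply: inU.
have [a [b [ah bh E1]]] := second_difference h0 inU du duv.
have [b' [a' [bh' ah' E2]]] := second_difference h0 inU' dv dvu.
have [_ H1 _] := dP _ (near_q _ _ ah bh).
have [_ _ ] := dP _ (near_q _ _ ah' bh') => H2.
have E3 : 'D_v ('D_u F) (a *: u + (b *: v + q))
        = 'D_u ('D_v F) (a' *: u + (b' *: v + q)).
  apply: (@mulIf _ (h ^+ 2)); first by rewrite expf_neq0 // gt_eqF.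
  apply: etrans (esym E1) _; rewrite (addrCA (a' *: u)) -E2 (addrCA (h *: v)).
  by ring.
move: H1 H2; rewrite E3 => H1 H2.
have := le_lt_trans (ler_normB _ _) (ltrD H1 H2).
move: ('D_u ('D_v F) (a' *: u + (b' *: v + q))) => c.
have -> : A - c - (B - c) = A - B by ring.
by rewrite -splitr ltxx.
Qed.
End symmetry_of_second_derivatives.

(** * Vector-valued maps: products, orthogonal expansions and commuting derivatives *)

Section vector_calculus.
Context {R : realType}.

Lemma is_derive_coord (V : normedModType R) m n (A : V -> 'M[R]_(m, n)) x v dA i j :
  is_derive x v A dA -> is_derive x v (fun y => A y i j) (dA i j).
Proof.
move=> [dA1 <-]; split; first exact/(derivable_mxP A x v).1.
by rewrite derive_mx // mxE.
Qed.

Lemma is_derive_eucl_dot (V : normedModType R) k (A B : V -> 'rV[R]_k) x v dA dB :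
  is_derive x v A dA -> is_derive x v B dB ->
  is_derive x v (fun y => eucl_dot (A y) (B y))
    (eucl_dot dA (B x) + eucl_dot (A x) dB).
Proof.
move=> hA hB; rewrite /eucl_dot.
have -> : (fun y => \sum_i A y 0 i * B y 0 i) =
    \sum_i ((fun y => A y 0 i) * (fun y => B y 0 i)).
  by apply/funext => y; rewrite fct_sumE.
apply: is_derive_eq.
  apply: is_derive_sum => i; apply: is_deriveM; exact: is_derive_coord.
rewrite -big_split /=; apply: eq_bigr => i _.
by rewrite addrC; congr (_ + _); exact: mulrC.
Qed.

Lemma eucl_dotC k (x y : 'rV[R]_k) : eucl_dot x y = eucl_dot y x.
Proof. by apply: eq_bigr => i _; rewrite mulrC. Qed.

Lemma eucl_dotE k (x y : 'rV[R]_k) : eucl_dot x y = (x *m y^T) 0 0.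
Proof. by rewrite mxE; apply: eq_bigr => i _; rewrite mxE. Qed.

Lemma eucl_dot_gt0 k (x : 'rV[R]_k) : x != 0 -> 0 < eucl_dot x x.
Proof.
move=> x0; rewrite lt_def sumr_ge0 ?andbT => [|i _]; last by rewrite -expr2 sqr_ge0.
apply: contra x0 => /eqP e0; apply/eqP/rowP => i; rewrite mxE; apply/eqP.
rewrite -sqrf_eq0 eq_le sqr_ge0 andbT expr2 -e0 /eucl_dot (bigD1 i) //= lerDl.
by apply: sumr_ge0 => j _; rewrite -expr2 sqr_ge0.
Qed.

(** With the [B i] as rows of [M] and the inverse squared norms in [D], orthogonality says that
    [M^T *m D] is a right inverse of [M]. For a square matrix it is also a left inverse, and
    inserting the resulting completeness relation between [x] and [y] gives Parseval's identity. *)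
Lemma eucl_dot_orthogonal_basis k (B : 'I_k -> 'rV[R]_k) (x y : 'rV[R]_k) :
  (forall i, B i != 0) -> (forall i j, i != j -> eucl_dot (B i) (B j) = 0) ->
  eucl_dot x y =
  \sum_i eucl_dot x (B i) * eucl_dot y (B i) / eucl_dot (B i) (B i).
Proof.
move=> B0 Bo.
pose M := \matrix_i B i; pose D := diag_mx (\row_i (eucl_dot (B i) (B i))^-1).
have MD : M *m (M^T *m D) = 1%:M.
  apply/matrixP => i j; rewrite mulmxA mul_mx_diag !mxE.
  have -> : \sum_l M i l * M^T l j = eucl_dot (B i) (B j).
    by apply: eq_bigr => l _; rewrite !mxE.
  have [->|ij] := eqVneq i j; last by rewrite Bo ?mul0r.
  by rewrite divff // gt_eqF // eucl_dot_gt0.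
have {MD}/mulmx1C MD := MD.
rewrite eucl_dotE -[x in LHS]mulmx1 -MD.
have -> : x *m (M^T *m D *m M) *m y^T = x *m M^T *m D *m (M *m y^T).
  by rewrite !mulmxA.
rewrite mxE; apply: eq_bigr => i _; rewrite mul_mx_diag !mxE mulrAC.
congr (_ * _ / _).
  by apply: eq_bigr => l _; rewrite !mxE.
by apply: eq_bigr => l _; rewrite !mxE mulrC.
Qed.

Section open_set.
Variables (n : nat) (U : set 'rV[R]_n).
Hypothesis oU : open U.

Lemma smooth_map_differentiable k (F : 'rV[R]_n -> 'rV[R]_k) q :
  smooth_map_on U F -> U q -> differentiable F q.
Proof.
by move=> sF Uq; apply: differentiable_rV => j; exact: (sF j [::]).
Qed.

Lemma tpartialE k (F : 'rV[R]_n -> 'rV[R]_k) i q c :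
  smooth_map_on U F -> U q -> tpartial i F q 0 c = partial i (fun x => F x 0 c) q.
Proof.
move=> sF Uq; rewrite /tpartial derive_mx ?mxE //.
exact/diff_derivable/smooth_map_differentiable.
Qed.

Lemma smooth_map_tpartial k (F : 'rV[R]_n -> 'rV[R]_k) i :
  smooth_map_on U F -> smooth_map_on U (tpartial i F).
Proof.
move=> sF c; apply: (smooth_on_eq oU (F := partial i (fun x => F x 0 c))).
  by move=> q Uq; rewrite tpartialE.
exact: smooth_on_partial.
Qed.

Lemma partialC (F : 'rV[R]_n -> R) i j q : smooth_on U F -> U q ->
  partial i (partial j F) q = partial j (partial i F) q.
Proof.
move=> sF Uq; have dF s q' v : U q' -> derivable (foldr (@partial R n) F s) q' v.
  by move=> Uq'; exact/diff_derivable/sF.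
apply: (@derive_symmetric _ _ F U q (delta_mx 0 j) (delta_mx 0 i) oU Uq).
- by move=> x; exact: (dF [::]).
- by move=> x; exact: (dF [::]).
- by move=> x; exact: (dF [:: j]).
- by move=> x; exact: (dF [:: i]).
- exact: differentiable_continuous (sF [:: i; j] q Uq).
- exact: differentiable_continuous (sF [:: j; i] q Uq).
Qed.

Lemma tpartialC k (F : 'rV[R]_n -> 'rV[R]_k) i j q :
  smooth_map_on U F -> U q ->
  tpartial i (tpartial j F) q = tpartial j (tpartial i F) q.
Proof.
move=> sF Uq; have sT l := smooth_map_tpartial l sF.
apply/rowP => c.
apply: etrans (tpartialE i c (sT j) Uq) _.
apply: etrans _ (esym (tpartialE j c (sT i) Uq)).
have E l l' : partial l (fun x => tpartial l' F x 0 c) q =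
    partial l (partial l' (fun x => F x 0 c)) q.
  by apply: (eq_partial oU _ _ Uq) => x Ux; exact: tpartialE.
rewrite !E; exact: partialC (sF c) Uq.
Qed.

Lemma is_derive_smooth_map k (F : 'rV[R]_n -> 'rV[R]_k) i q :
  smooth_map_on U F -> U q -> is_derive q (delta_mx 0 i) F (tpartial i F q).
Proof.
by move=> sF Uq; apply/derivableP/diff_derivable/smooth_map_differentiable.
Qed.

End open_set.
End vector_calculus.

(** * The unit sphere in orthogonal coordinates *)

Lemma is_derive_inv (R : realType) (V : normedModType R) (F : V -> R) x v dF :
  F x != 0 -> is_derive x v F dF ->
  is_derive x v (fun y => (F y)^-1) (- (F x) ^- 2 * dF).
Proof.
by move=> F0 [dF1 <-]; split; [exact: derivableV | rewrite deriveV].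
Qed.

Lemma invmx_eq (F : comUnitRingType) n (A B : 'M[F]_n) : A *m B = 1%:M -> invmx A = B.
Proof.
move=> AB; have [uA _] := mulmx1_unit AB.
by rewrite -[LHS]mulmx1 -AB mulKmx.
Qed.

Section sphere.
Context {R : realType}.
Variables (m : nat) (V : set 'rV[R]_m) (X : 'rV[R]_m -> 'rV[R]_m.+1).
Hypothesis XP : orthogonal_sphere_param V X.

Let oV : open V. Proof. by case: XP. Qed.
Let sX : smooth_map_on V X. Proof. by case: XP. Qed.
Definition sphere_metric (v : 'rV[R]_m) : 'M[R]_m :=
  \matrix_(i, j) eucl_dot (tpartial i X v) (tpartial j X v).

(* The derivatives of X are named by variables: unification would otherwise
   unfold [derive] whenever it compares two of them. *)
Section frame.
Variables (T : 'I_m -> 'rV[R]_m -> 'rV[R]_m.+1).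
Variables (TT : 'I_m -> 'I_m -> 'rV[R]_m -> 'rV[R]_m.+1).
Hypothesis TE : forall i, T i = tpartial i X.
Hypothesis TTE : forall i j, TT i j = tpartial i (T j).
Let sT i : smooth_map_on V (T i).
Proof. by rewrite TE; exact: smooth_map_tpartial. Qed.
Let sTT i j : smooth_map_on V (TT i j).
Proof. by rewrite TTE; exact: smooth_map_tpartial. Qed.

Let g v i j := eucl_dot (T i v) (T j v).
Let a v i j l := eucl_dot (TT i j v) (T l v).

Let sphere_metricE v i j : sphere_metric v i j = g v i j.
Proof. by rewrite mxE -!TE. Qed.

Let g0 v i j : V v -> i != j -> g v i j = 0.
Proof.
move=> Vv ij; rewrite /g !TE.
by case: XP => _ _ _ /(_ v Vv)[_ _]; exact.
Qed.

Let g_gt0 v i : V v -> 0 < g v i i.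
Proof.
move=> Vv; rewrite /g TE; apply: eucl_dot_gt0.
by case: XP => _ _ _ /(_ v Vv)[_ /(_ i)].
Qed.

Let g_neq0 v i : V v -> g v i i != 0.
Proof. by move=> Vv; rewrite gt_eqF // g_gt0. Qed.

Let gC v i j : g v i j = g v j i. Proof. exact: eucl_dotC. Qed.

Let sphere_metricV v : V v ->
  sphere_metric v *m diag_mx (\row_i (g v i i)^-1) = 1%:M.
Proof.
move=> Vv; apply/matrixP => i j; rewrite mul_mx_diag mxE sphere_metricE 2!mxE.
have [->|ij] := eqVneq i j; first by rewrite divff // g_neq0.
by rewrite g0 // mul0r.
Qed.

Lemma sphere_metric_unit v : V v -> sphere_metric v \in unitmx.
Proof. by move=> Vv; case/mulmx1_unit: (sphere_metricV Vv). Qed.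

Let dT v i j : V v -> is_derive v (delta_mx 0 i) (T j) (TT i j v).
Proof. by move=> Vv; rewrite TTE; exact: is_derive_smooth_map. Qed.

Let dg v i j l : V v ->
  is_derive v (delta_mx 0 i) (fun y => g y j l) (a v i j l + a v i l j).
Proof.
move=> Vv; rewrite {2}/a eucl_dotC.
exact: is_derive_eucl_dot (dT i j Vv) (dT i l Vv).
Qed.

Lemma is_derive_sphere_metric v i j l : V v ->
  is_derive v (delta_mx 0 i) (fun y => sphere_metric y j l) (a v i j l + a v i l j).
Proof.
move=> Vv; have -> : (fun y => sphere_metric y j l) = (fun y => g y j l).
  by apply/funext => y; rewrite sphere_metricE.
exact: dg.
Qed.

Let aC v i j l : V v -> a v i j l = a v j i l.
Proof. by move=> Vv; rewrite /a !TTE !TE (tpartialC oV i j sX Vv). Qed.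

(** For [j != l] the left side is the derivative of [g j l], which vanishes throughout [V] and not
    just at [v]. *)
Let a_skew v i j l : V v -> a v i j l + a v i l j = (a v i j j *+ 2) *+ (j == l).
Proof.
move=> Vv; have [->|jl] := eqVneq j l; first by rewrite mulr2n.
rewrite mulr0n; have [_ <-] := dg i j l Vv.
rewrite -(derive_cst (0 : R) v (delta_mx 0 i)).
apply: near_eq_derive; apply: near_open oV Vv _ => y Vy.
by rewrite g0.
Qed.

Lemma sphere_param_normal v i : V v -> eucl_dot (T i v) (X v) = 0.
Proof.
move=> Vv; have dX := is_derive_smooth_map i sX Vv.
have [_] := is_derive_eucl_dot dX dX; rewrite [X in _ + X]eucl_dotC.
have -> : 'D_(delta_mx 0 i) (fun y => eucl_dot (X y) (X y)) v = 0.
  rewrite -(derive_cst (1 : R) v (delta_mx 0 i)).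
  apply: near_eq_derive; apply: near_open oV Vv _ => y Vy.
  by case: XP => _ _ _ /(_ y Vy)[].
by rewrite -TE => /esym/eqP; rewrite -mulr2n mulrn_eq0 /= => /eqP.
Qed.

(** Differentiate the orthogonality of [T j] and [X]: the second fundamental form of the unit sphere
    with respect to its outer normal [X] is minus the metric. *)
Let TTX v i j : V v -> eucl_dot (TT i j v) (X v) = - g v i j.
Proof.
move=> Vv; have dX := is_derive_smooth_map i sX Vv.
have [_] := is_derive_eucl_dot (dT i j Vv) dX.
have -> : 'D_(delta_mx 0 i) (fun y => eucl_dot (T j y) (X y)) v = 0.
  rewrite -(derive_cst (0 : R) v (delta_mx 0 i)).
  by apply: near_eq_derive; apply: near_open oV Vv _ => y Vy; exact: sphere_param_normal.
by rewrite -TE gC => /esym/eqP; rewrite addr_eq0 => /eqP.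
Qed.

Let TT_dot v i h j k : V v -> eucl_dot (TT i h v) (TT j k v) =
  \sum_l a v i h l * a v j k l / g v l l + g v i h * g v j k.
Proof.
move=> Vv.
(* The normal [X] sits at index [ord0], before the tangent vectors. As it has length one, its term
   is the product of two second fundamental forms, whence [g v i h * g v j k]. *)
pose B (l : 'I_m.+1) := if unlift ord0 l is Some l' then T l' v else X v.
have XX : eucl_dot (X v) (X v) = 1 by case: XP => _ _ _ /(_ v Vv)[].
rewrite (@eucl_dot_orthogonal_basis _ _ B).
- rewrite big_ord_recl /= /B unlift_none XX !TTX // mulrNN divr1 addrC.
  by congr (_ + _); apply: eq_bigr => l _; rewrite liftK.
- move=> l; rewrite /B; case: unliftP => [l' _|_].
    by rewrite TE; case: XP => _ _ _ /(_ v Vv)[_ /(_ l')].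
  apply/eqP => X0; move: XX; rewrite X0 /eucl_dot big1 => [/esym/eqP|? _].
    by rewrite oner_eq0.
  by rewrite mxE mul0r.
- move=> l l'; rewrite /B; case: unliftP => [k1 ->|->]; case: unliftP => [k2 ->|->].
  + by rewrite (inj_eq lift_inj) => ?; exact: g0.
  + by move=> _; exact: sphere_param_normal.
  + by move=> _; rewrite eucl_dotC; exact: sphere_param_normal.
  + by rewrite eqxx.
Qed.

(** The inverse metric is diagonal, so only [l = k] survives. In the three metric derivatives four
    of the six terms cancel by the symmetry [aC], leaving twice [a v i j k]: the symbol is the
    [T k]-coefficient of the second derivative of [X]. *)
Lemma christoffel_sphere k i j v : V v ->
  christoffel sphere_metric k i j v = a v i j k / g v k k.
Proof.
move=> Vv; rewrite /christoffel (invmx_eq (sphere_metricV Vv)) (bigD1 k) //= big1.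
  rewrite !mxE eqxx mulr1n addr0 /partial.
  have [_ ->] := is_derive_sphere_metric i j k Vv.
  have [_ ->] := is_derive_sphere_metric j i k Vv.
  have [_ ->] := is_derive_sphere_metric k i j Vv.
  rewrite (aC k i j Vv) (aC k j i Vv) (aC j i k Vv) -/(g v k k).
  by field; exact: g_neq0.
by move=> l lk; rewrite !mxE eq_sym (negbTE lk) mulr0n mul0r.
Qed.

Let c v k i j := a v i j k / g v k k.

(* The third derivative of X is symmetric in j and i up to these Christoffel
   terms: [TT_dot] is the Gauss formula (the X-component of TT i j is - g i j),
   and [a_skew] converts its quadratic terms into products of symbols. *)
Let partial_christoffel k i h j v : V v ->
  partial j (christoffel sphere_metric k i h) v =
  eucl_dot (tpartial j (TT i h) v) (T k v) / g v k k
  - \sum_l c v l i h * c v k j l + g v i h * g v j k / g v k k.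
Proof.
move=> Vv; rewrite (eq_partial oV (christoffel_sphere k i h) _ Vv).
have dTT := is_derive_smooth_map j (sTT i h) Vv.
have [_ dc] := is_deriveM (is_derive_eucl_dot dTT (dT j k Vv))
  (@is_derive_inv _ _ (fun y => g y k k) _ _ _ (g_neq0 k Vv) (dg j k k Vv)).
apply: etrans dc _; rewrite TT_dot //.
(* For [l != k] the skew-symmetry exchanges the last two indices at the cost of a sign. The term
   [l = k] has no such sign, and the surplus it creates cancels the derivative of the factor
   [1 / g k k]. *)
have -> : \sum_l a v i h l * a v j k l / g v l l =
    a v i h k * (a v j k k *+ 2) / g v k k - g v k k * \sum_l c v l i h * c v k j l.
  rewrite mulr_sumr; apply/eqP; rewrite eq_sym subr_eq -big_split /=; apply/eqP.
  rewrite (bigD1 k) //= big1 => [|l lk].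
    by rewrite addr0 /c; field; exact: g_neq0.
  have := a_skew j k l Vv; rewrite eq_sym (negbTE lk) mulr0n => /eqP.
  rewrite addr_eq0 => /eqP ->; rewrite /c; field.
  by rewrite !g_neq0.
rewrite -/(a v i h k) /GRing.scale /=.
by field; exact: g_neq0.
Qed.

Let tpartialC3 i j k v : V v ->
  tpartial k (TT i j) v = tpartial j (TT i k) v.
Proof.
move=> Vv.
have E l l' l'' : tpartial l (TT l' l'') v = tpartial l (TT l'' l') v.
  apply: near_eq_derive; apply: near_open oV Vv _ => y Vy.
  by rewrite !TTE !TE; exact: (tpartialC oV _ _ sX Vy).
rewrite E [RHS]E !TTE.
exact: (tpartialC oV _ _ (sT i) Vv).
Qed.

(** The identity already holds for each [k] separately: the third derivatives and the quadratic
    terms cancel, leaving [g i j - g i k * g j k / g k k]. Summed over [k] this is [m - 1] times the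
    metric, and [m - 1 = n - 2] for a hypersurface of dimension [n = m + 1]. *)
Lemma ricci_sphere v : V v ->
  ricci sphere_metric v = (m%:R - 1) *: sphere_metric v.
Proof.
move=> Vv; apply/matrixP => i j; rewrite mxE [RHS]mxE sphere_metricE.
have -> : (m%:R - 1) * g v i j = \sum_k (g v i j - g v i k * g v j k / g v k k).
  rewrite sumrB sumr_const card_ord mulrBl mul1r mulr_natl; congr (_ - _).
  rewrite (bigD1 i) //= big1 => [|k ki]; last by rewrite g0 1?eq_sym ?mul0r.
  by rewrite addr0 mulrAC divff ?mul1r ?g_neq0 // gC.
rewrite -big_split /=; apply: eq_bigr => k _.
rewrite !partial_christoffel // (tpartialC3 i j k Vv).
under eq_bigr => l _ do rewrite !christoffel_sphere //.
rewrite sumrB.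
have -> : \sum_l a v k l k / g v k k * (a v i j l / g v l l) =
    \sum_l c v l i j * c v k k l by apply: eq_bigr => l _; rewrite mulrC.
have -> : \sum_l a v j l k / g v k k * (a v i k l / g v l l) =
    \sum_l c v l i k * c v k j l by apply: eq_bigr => l _; rewrite mulrC.
by field; exact: g_neq0.
Qed.

End frame.
End sphere.

(** * Warped products *)

(* [Gam k i j] and [dGam h k i j] stand for the Christoffel symbol with upper
   index k and its h-th derivative at a point of ds^2 + sigma^2 g, with
   r = sigma' / sigma and b = sigma * sigma'. *)
Section warped_ricci_algebra.
Variables (R : fieldType) (m : nat).
Variables (Gam : 'I_m.+1 -> 'I_m.+1 -> 'I_m.+1 -> R).
Variables (dGam : 'I_m.+1 -> 'I_m.+1 -> 'I_m.+1 -> 'I_m.+1 -> R).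
Variables (c : 'I_m -> 'I_m -> 'I_m -> R) (dc : 'I_m -> 'I_m -> 'I_m -> 'I_m -> R).
Variables (g : 'M[R]_m) (r r' b b' : R).
Let l : 'I_m -> 'I_m.+1 := lift ord0.
Hypothesis G000 : Gam ord0 ord0 ord0 = 0.
Hypothesis G00j : forall j, Gam ord0 ord0 (l j) = 0.
Hypothesis G0i0 : forall i, Gam ord0 (l i) ord0 = 0.
Hypothesis G0ij : forall i j, Gam ord0 (l i) (l j) = - (b * g i j).
Hypothesis Gk00 : forall k, Gam (l k) ord0 ord0 = 0.
Hypothesis Gk0j : forall k j, Gam (l k) ord0 (l j) = r *+ (k == j).
Hypothesis Gki0 : forall k i, Gam (l k) (l i) ord0 = r *+ (k == i).
Hypothesis Gkij : forall k i j, Gam (l k) (l i) (l j) = c k i j.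
Hypothesis dG00j : forall h j, dGam h ord0 ord0 j = 0.
Hypothesis dG0i0 : forall h i, dGam h ord0 i ord0 = 0.
Hypothesis dG0ij : forall i j, dGam ord0 ord0 (l i) (l j) = - (b' * g i j).
Hypothesis dGk00 : forall h k, dGam h (l k) ord0 ord0 = 0.
Hypothesis d0Gk0j : forall k j, dGam ord0 (l k) ord0 (l j) = r' *+ (k == j).
Hypothesis dlGk0j : forall h k j, dGam (l h) (l k) ord0 (l j) = 0.
Hypothesis dlGki0 : forall h k i, dGam (l h) (l k) (l i) ord0 = 0.
Hypothesis d0Gkij : forall k i j, dGam ord0 (l k) (l i) (l j) = 0.
Hypothesis dlGkij : forall h k i j, dGam (l h) (l k) (l i) (l j) = dc h k i j.
Hypothesis gC : forall i j, g i j = g j i.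
Hypothesis cC : forall k i j, c k i j = c k j i.

Let ric i j := (\sum_k (dGam k k i j - dGam j k i k))
  + \sum_k \sum_h (Gam k k h * Gam h i j - Gam k j h * Gam h i k).

Let sum_delta (F : 'I_m -> R) i : \sum_k F k *+ (k == i) = F i.
Proof.
by rewrite (bigD1 i) //= eqxx mulr1n big1 ?addr0 // => k /negbTE ->.
Qed.

Let sumn_delta (x : R) : \sum_(k < m) x *+ (k == k) = m%:R * x.
Proof.
by under eq_bigr do rewrite eqxx mulr1n; rewrite sumr_const card_ord mulr_natl.
Qed.

Let ricE i j : ric i j =
  (dGam ord0 ord0 i j - dGam j ord0 i ord0)
  + \sum_k (dGam (l k) (l k) i j - dGam j (l k) i (l k))
  + (Gam ord0 ord0 ord0 * Gam ord0 i j - Gam ord0 j ord0 * Gam ord0 i ord0)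
  + \sum_h (Gam ord0 ord0 (l h) * Gam (l h) i j - Gam ord0 j (l h) * Gam (l h) i ord0)
  + \sum_k (Gam (l k) (l k) ord0 * Gam ord0 i j
             - Gam (l k) j ord0 * Gam ord0 i (l k))
  + \sum_k \sum_h (Gam (l k) (l k) (l h) * Gam (l h) i j
             - Gam (l k) j (l h) * Gam (l h) i (l k)).
Proof.
rewrite /ric !big_ord_recl -!addrA; do 6 congr (_ + _).
by rewrite -big_split /=; apply: eq_bigr => k _; rewrite big_ord_recl.
Qed.

(** Each of the [m] spherical directions contributes [- r'] from the derivative of
    [Gam (l k) ord0 (l k)] and [- r ^+ 2] from its square. For [r = sigma' / sigma] the sum
    [r' + r ^+ 2] is [sigma'' / sigma]. *)
Lemma warped_ric00 : ric ord0 ord0 = - (m%:R * (r' + r ^+ 2)).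
Proof.
rewrite ricE !dG00j !G000 mulr0 !subrr !add0r addr0.
rewrite (eq_bigr (fun k => - (r' *+ (k == k)))); last first.
  by move=> k _; rewrite dGk00 d0Gk0j sub0r.
rewrite [X in _ + X + _ + _]big1 => [|h _]; last by rewrite !G00j !mul0r subrr.
rewrite [X in _ + X + _]big1 => [|k _]; last by rewrite Gk00 G00j mulr0 mul0r subrr.
rewrite [X in _ + X](eq_bigr (fun k => - (r ^+ 2 *+ (k == k)))); last first.
  move=> k _; rewrite (eq_bigr (fun h => - (r * (r *+ (h == k)) *+ (h == k)))).
    by rewrite sumrN sum_delta eqxx expr2.
  by move=> h _; rewrite Gk00 !Gk0j mulr0 sub0r [k == h]eq_sym mulrnAl.
by rewrite !sumrN !sumn_delta !addr0 -opprD -mulrDr.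
Qed.

(** What survives is [r] times the difference of two traces of [c], which agree because [c] is
    symmetric in its lower indices. *)
Lemma warped_ric0j j : ric ord0 (l j) = 0.
Proof.
rewrite ricE !G000 !G00j !dG00j !G0i0 !mul0r !subrr !add0r.
rewrite big1 ?add0r => [|k _]; last first.
  by rewrite !dlGk0j subrr.
rewrite [X in X + _ + _]big1 ?add0r => [|h _]; last first.
  by rewrite Gk00 G00j mul0r mulr0 subrr.
rewrite [X in X + _]big1 ?add0r => [|k _]; last by rewrite !G00j !mulr0 subrr.
rewrite (eq_bigr (fun k => r * c k k j - r * c k j k)) => [|k _].
  by rewrite big1 // => k _; rewrite cC subrr.
rewrite sumrB (eq_bigr (fun h => r * c k k h *+ (h == j))) => [|h _]; last first.
  by rewrite Gkij Gk0j mulrnAr mulrC.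
rewrite [X in _ - X](eq_bigr (fun h => r * c k j h *+ (h == k))) => [|h _].
  by rewrite !sum_delta.
by rewrite Gkij Gk0j mulrnAr mulrC.
Qed.

Lemma warped_ricj0 j : ric (l j) ord0 = 0.
Proof.
rewrite ricE !G000 !G0i0 !dG0i0 !mul0r !subrr !add0r.
rewrite big1 ?add0r => [|k _]; last first.
  by rewrite dlGki0 d0Gkij subrr.
rewrite [X in X + _ + _]big1 ?add0r => [|h _]; last first.
  by rewrite !G00j !mul0r subrr.
rewrite [X in X + _]big1 ?add0r => [|k _]; last by rewrite Gk00 mulr0 mul0r subrr.
rewrite (eq_bigr (fun k => r * c k k j - r * c k j k)) => [|k _].
  by rewrite big1 // => k _; rewrite cC subrr.
rewrite sumrB (eq_bigr (fun h => r * c k k h *+ (h == j))) => [|h _]; last first.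
  by rewrite Gkij Gki0 mulrnAr mulrC.
rewrite [X in _ - X](eq_bigr (fun h => r * c h j k *+ (h == k))) => [|h _].
  by rewrite !sum_delta.
by rewrite Gkij Gk0j mulrnAl eq_sym.
Qed.

(** The terms purely in [c] and [dc] rebuild the Ricci tensor of the spherical factor. The trace of
    [Gam (l k) (l k) ord0] gives [- m%:R], and the two mixed products give the [2]. With
    [r * b = sigma' ^+ 2] and [b' = sigma' ^+ 2 + sigma * sigma''] the coefficient of [g] is the
    usual [(1 - m) sigma' ^+ 2 - sigma * sigma'']. *)
Lemma warped_ricij i j : ric (l i) (l j) =
  ((2 - m%:R) * (r * b) - b') * g i j
  + (\sum_k (dc k k i j - dc j k i k)
     + \sum_k \sum_h (c k k h * c h i j - c k j h * c h i k)).
Proof.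
rewrite ricE dG0ij dG0i0 !G000 !G0i0 !mul0r !subr0 addr0.
have -> : \sum_k (dGam (l k) (l k) (l i) (l j) - dGam (l j) (l k) (l i) (l k)) =
    \sum_k (dc k k i j - dc j k i k) by apply: eq_bigr => k _; rewrite !dlGkij.
have -> : \sum_h (Gam ord0 ord0 (l h) * Gam (l h) (l i) (l j)
              - Gam ord0 (l j) (l h) * Gam (l h) (l i) ord0) = r * b * g i j.
  rewrite (gC i j) -(sum_delta (fun h => r * b * g j h) i).
  apply: eq_bigr => h _.
  by rewrite G00j G0ij Gki0 mul0r sub0r mulNr opprK mulrnAr mulrC mulrA.
have -> : \sum_k (Gam (l k) (l k) ord0 * Gam ord0 (l i) (l j)
             - Gam (l k) (l j) ord0 * Gam ord0 (l i) (l k)) =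
    - (m%:R * (r * b * g i j)) + r * b * g i j.
  rewrite -sumn_delta -[X in _ + X](sum_delta (fun k => r * b * g i k) j).
  rewrite -sumrN -big_split.
  apply: eq_bigr => k _ /=; rewrite G0ij !Gki0 G0ij !mulrN opprK.
  by rewrite !mulrnAl !mulrA.
have -> : \sum_k \sum_h (Gam (l k) (l k) (l h) * Gam (l h) (l i) (l j)
             - Gam (l k) (l j) (l h) * Gam (l h) (l i) (l k)) =
    \sum_k \sum_h (c k k h * c h i j - c k j h * c h i k).
  by apply: eq_bigr => k _; apply: eq_bigr => h _; rewrite !Gkij.
by ring.
Qed.

End warped_ricci_algebra.

(** The matrix of ds^2 + c A. Entries are selected by [unlift], so that [ord0] is the index of the
    coordinate s and [lift ord0 i] that of v_i, as in [spart] and [vpart]. *)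
Definition warp_mx (R : nzRingType) m (c : R) (A : 'M[R]_m) : 'M[R]_m.+1 :=
  \matrix_(i, j) match unlift ord0 i, unlift ord0 j with
                 | None, None => 1
                 | Some i', Some j' => c * A i' j'
                 | _, _ => 0
                 end.

Section warp_matrix.
Variables (R : comUnitRingType) (m : nat).
Implicit Types (c : R) (A B : 'M[R]_m).

Lemma warp_mx00 c A : warp_mx c A ord0 ord0 = 1.
Proof. by rewrite mxE unlift_none. Qed.

Lemma warp_mx0l c A j : warp_mx c A ord0 (lift ord0 j) = 0.
Proof. by rewrite mxE unlift_none liftK. Qed.

Lemma warp_mxl0 c A i : warp_mx c A (lift ord0 i) ord0 = 0.
Proof. by rewrite mxE unlift_none liftK. Qed.

Lemma warp_mxll c A i j :
  warp_mx c A (lift ord0 i) (lift ord0 j) = c * A i j.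
Proof. by rewrite mxE !liftK. Qed.

Definition warp_mxE := (warp_mx00, warp_mx0l, warp_mxl0, warp_mxll).

Lemma mul_warp_mx c d A B : warp_mx c A *m warp_mx d B = warp_mx (c * d) (A *m B).
Proof.
apply/matrixP => i j; rewrite [LHS]mxE big_ord_recl.
case: (unliftP ord0 i) => [i'|] ->; case: (unliftP ord0 j) => [j'|] ->;
  rewrite !warp_mxE ?mul0r ?mulr0 ?add0r ?mul1r.
- rewrite mxE mulr_sumr; apply: eq_bigr => k _.
  by rewrite !warp_mxE mulrACA.
- by rewrite big1 // => k _; rewrite !warp_mxE mulr0.
- by rewrite big1 // => k _; rewrite !warp_mxE mul0r.
- by rewrite big1 ?addr0 // => k _; rewrite !warp_mxE mul0r.
Qed.

Lemma warp_mx1 : warp_mx 1 (1%:M : 'M[R]_m) = 1%:M.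
Proof.
apply/matrixP => i j; rewrite [RHS]mxE.
case: (unliftP ord0 i) => [i'|] ->; case: (unliftP ord0 j) => [j'|] ->;
  rewrite !warp_mxE ?eqxx //.
by rewrite mul1r mxE (inj_eq lift_inj).
Qed.

Lemma invmx_warp_mx c A : c \is a GRing.unit -> A \in unitmx ->
  invmx (warp_mx c A) = warp_mx c^-1 (invmx A).
Proof.
by move=> uc uA; apply: invmx_eq; rewrite mul_warp_mx divrr // mulmxV // warp_mx1.
Qed.

End warp_matrix.

(* [D h i j] stands for the h-th derivative of the entry (i, j) of the metric
   ds^2 + s^2 g, and [gi] for the inverse of g. *)
Section warped_christoffel_algebra.
Variables (R : numFieldType) (m : nat).
Variables (D : 'I_m.+1 -> 'I_m.+1 -> 'I_m.+1 -> R) (dg : 'I_m -> 'I_m -> 'I_m -> R).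
Variables (g gi : 'M[R]_m) (s s' : R).
Let l : 'I_m -> 'I_m.+1 := lift ord0.
Hypothesis s0 : s != 0.
Hypothesis gig : gi *m g = 1%:M.
Hypothesis gC : forall i j, g i j = g j i.
Hypothesis D00 : forall h, D h ord0 ord0 = 0.
Hypothesis D0l : forall h j, D h ord0 (l j) = 0.
Hypothesis Dl0 : forall h i, D h (l i) ord0 = 0.
Hypothesis D0ll : forall i j, D ord0 (l i) (l j) = 2 * s * s' * g i j.
Hypothesis Dlll : forall h i j, D (l h) (l i) (l j) = s ^+ 2 * dg h i j.

Let Gam k i j :=
  2^-1 * \sum_h warp_mx (s ^+ 2)^-1 gi k h * (D i j h + D j i h - D h i j).

Let Gam0 i j : Gam ord0 i j = 2^-1 * (D i j ord0 + D j i ord0 - D ord0 i j).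
Proof.
rewrite /Gam big_ord_recl warp_mx00 mul1r big1 ?addr0 // => h _.
by rewrite warp_mx0l mul0r.
Qed.

Let Gaml k i j : Gam (l k) i j = 2^-1 * \sum_h (s ^+ 2)^-1 * gi k h *
  (D i j (l h) + D j i (l h) - D (l h) i j).
Proof.
rewrite /Gam big_ord_recl warp_mxl0 mul0r add0r; congr (_ * _).
by apply: eq_bigr => h _; rewrite warp_mxll.
Qed.

Lemma warped_Gam000 : Gam ord0 ord0 ord0 = 0.
Proof. by rewrite Gam0 !D00 subr0 addr0 mulr0. Qed.

Lemma warped_Gam00j j : Gam ord0 ord0 (l j) = 0.
Proof. by rewrite Gam0 D00 D0l Dl0 subr0 addr0 mulr0. Qed.

Lemma warped_Gam0i0 i : Gam ord0 (l i) ord0 = 0.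
Proof. by rewrite Gam0 D00 !Dl0 subr0 addr0 mulr0. Qed.

Lemma warped_Gam0ij i j : Gam ord0 (l i) (l j) = - (s * s' * g i j).
Proof. by rewrite Gam0 !Dl0 D0ll; field. Qed.

Lemma warped_Gamk00 k : Gam (l k) ord0 ord0 = 0.
Proof. by rewrite Gaml big1 ?mulr0 // => h _; rewrite !D0l D00 subr0 addr0 mulr0. Qed.

Lemma warped_Gamk0j k j : Gam (l k) ord0 (l j) = (s' / s) *+ (k == j).
Proof.
(* Written as an entry of [gi *m g], the Kronecker delta becomes a sum over [h], and the claim can
   be checked term by term. *)
have -> : s' / s *+ (k == j) = s' / s * (gi *m g) k j.
  by rewrite gig mxE mulr_natr.
rewrite Gaml mxE !mulr_sumr; apply: eq_bigr => h _.
by rewrite D0ll !D0l (gC j); field.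
Qed.

Lemma warped_Gamki0 k i : Gam (l k) (l i) ord0 = (s' / s) *+ (k == i).
Proof.
have -> : s' / s *+ (k == i) = s' / s * (gi *m g) k i.
  by rewrite gig mxE mulr_natr.
rewrite Gaml mxE !mulr_sumr; apply: eq_bigr => h _.
by rewrite D0ll D0l Dl0 (gC i); field.
Qed.

Lemma warped_Gamkij k i j : Gam (l k) (l i) (l j) =
  2^-1 * \sum_h gi k h * (dg i j h + dg j i h - dg h i j).
Proof.
rewrite Gaml; congr (_ * _); apply: eq_bigr => h _.
by rewrite !Dlll; field.
Qed.

End warped_christoffel_algebra.

(** * The coordinates (s, v) and the geometry of ds^2 + sigma(s)^2 g *)

Section warped_product.
Context {R : realType}.

Section coordinates.
Variable m : nat.
Implicit Types (q : 'rV[R]_m.+1) (F : R -> R) (P : 'rV[R]_m -> R).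

Lemma is_derive_spart_s F q : derivable F (spart q) 1 ->
  is_derive q (delta_mx 0 ord0) (F \o @spart R m) (F^`()%classic (spart q)).
Proof.
move=> dF; apply: (@is_derive_comp_affine _ _ _ _ _ _ _ _ (1 : R)).
  by move=> h; rewrite /spart !mxE eqxx.
by rewrite derive1E; exact/derivableP.
Qed.

Lemma is_derive_spart_v F q i :
  is_derive q (delta_mx 0 (lift ord0 i)) (F \o @spart R m) 0.
Proof.
apply: (@is_derive_comp_affine _ _ _ _ _ _ _ _ (0 : R)); last exact: is_derive0.
by move=> h; rewrite /spart !mxE eqxx mulr0 scaler0.
Qed.

Lemma is_derive_vpart_s P q :
  is_derive q (delta_mx 0 ord0) (P \o @vpart R m) 0.
Proof.
apply: (@is_derive_comp_affine _ _ _ _ _ _ _ _ (0 : 'rV[R]_m)); last exact: is_derive0.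
by move=> h; apply/rowP => j; rewrite /vpart !mxE eqxx mulr0.
Qed.

Let vpart_affine q i (h : R) :
  vpart (h *: delta_mx 0 (lift ord0 i) + q) = h *: delta_mx 0 i + vpart q.
Proof. by apply/rowP => j; rewrite /vpart !mxE (inj_eq lift_inj). Qed.

(** Both sides are limits of the same difference quotients. It is applied to the Christoffel symbols
    of [g], whose derivability is not among the assumptions on the spherical factor. *)
Lemma partial_vpart P q i :
  partial (lift ord0 i) (P \o @vpart R m) q = partial i P (vpart q).
Proof. exact: derive_comp_affine. Qed.

Lemma is_derive_vpart_v P q i : derivable P (vpart q) (delta_mx 0 i) ->
  is_derive q (delta_mx 0 (lift ord0 i)) (P \o @vpart R m) (partial i P (vpart q)).
Proof.
by move=> dP; apply: is_derive_comp_affine (derivableP dP); exact: vpart_affine.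
Qed.

End coordinates.

End warped_product.

Section warped_product_geometry.
Context {R : realType}.
Variables (m : nat) (I : set R) (V : set 'rV[R]_m).
Variables (sigma : R -> R) (g : 'rV[R]_m -> 'M[R]_m) (G : 'rV[R]_m.+1 -> 'M[R]_m.+1).
Let U : set 'rV[R]_m.+1 := [set q | I (spart q) /\ V (vpart q)].
Let l : 'I_m -> 'I_m.+1 := lift ord0.
Let sigma' := sigma^`()%classic.
Let sigma'' := sigma'^`()%classic.
Hypothesis oU : open U.
Hypothesis oV : open V.
Hypothesis sigma_neq0 : forall s, I s -> sigma s != 0.
Hypothesis d_sigma : forall s, I s -> derivable sigma s 1.
Hypothesis d_sigma' : forall s, I s -> derivable sigma' s 1.
Hypothesis g_sym : forall v i j, V v -> g v i j = g v j i.
Hypothesis g_unit : forall v, V v -> g v \in unitmx.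
Hypothesis d_g : forall v h i j, V v -> derivable (fun x => g x i j) v (delta_mx 0 h).
Hypothesis GE : forall q, U q -> G q = warp_mx (sigma (spart q) ^+ 2) (g (vpart q)).

Let partial0 (F : 'rV[R]_m.+1 -> R) h q : (forall q, U q -> F q = 0) -> U q ->
  partial h F q = 0.
Proof.
move=> F0 Uq; apply: etrans (eq_partial oU (G := cst 0) F0 h Uq) _.
exact: derive_cst.
Qed.

Let partial_eq (F F' : 'rV[R]_m.+1 -> R) h q d : (forall q, U q -> F q = F' q) -> U q ->
  is_derive q (delta_mx 0 h) F' d -> partial h F q = d.
Proof. by move=> FF Uq [_ <-]; exact: (eq_partial oU FF). Qed.

Let d_sigma_s s : I s -> is_derive s (1 : R) sigma (sigma' s).
Proof. by move=> Is; rewrite /sigma' derive1E; apply/derivableP/d_sigma. Qed.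

Let d_sigma'_s s : I s -> is_derive s (1 : R) sigma' (sigma'' s).
Proof. by move=> Is; rewrite /sigma'' derive1E; apply/derivableP/d_sigma'. Qed.

Section at_point.
Variable q : 'rV[R]_m.+1.
Hypothesis Uq : U q.
Let s := spart q.
Let v := vpart q.
Let Is : I s. Proof. by case: Uq. Qed.
Let Vv : V v. Proof. by case: Uq. Qed.

Let s_is_derive (F : R -> R) (d : R) : is_derive s (1 : R) F d ->
  is_derive q (delta_mx 0 ord0) (F \o @spart R m) d.
Proof.
move=> [dF dFE]; have := is_derive_spart_s dF.
by rewrite derive1E dFE.
Qed.

Let D h i j := partial h (fun x => G x i j) q.

Let D00 h : D h ord0 ord0 = 0.
Proof.
apply: (partial_eq (F' := cst 1)) => // x Ux; by rewrite GE // warp_mx00.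
Qed.

Let D0l h j : D h ord0 (l j) = 0.
Proof. by apply: partial0 => // x Ux; rewrite GE // warp_mx0l. Qed.

Let Dl0 h j : D h (l j) ord0 = 0.
Proof. by apply: partial0 => // x Ux; rewrite GE // warp_mxl0. Qed.

Let GllE i j x : U x -> G x (l i) (l j) =
  (((fun y => sigma y ^+ 2) \o @spart R m) * ((fun y => g y i j) \o @vpart R m)) x.
Proof. by move=> Ux; rewrite GE // warp_mxll. Qed.

Let D0ll i j : D ord0 (l i) (l j) = 2 * sigma s * sigma' s * g v i j.
Proof.
apply: (partial_eq (GllE i j) Uq).
have ds2 : is_derive s (1 : R) (fun y => sigma y ^+ 2) (2 * sigma s * sigma' s).
  by apply: is_derive_eq (is_deriveX 2 (d_sigma_s Is)) _; rewrite expr1.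
apply: is_derive_eq (is_deriveM (s_is_derive ds2)
  (is_derive_vpart_s (fun y => g y i j) q)) _.
by rewrite scaler0 add0r [LHS]mulrC.
Qed.

Let Dlll h i j : D (l h) (l i) (l j) =
  sigma s ^+ 2 * partial h (fun x => g x i j) v.
Proof.
apply: (partial_eq (GllE i j) Uq).
have h1 := is_derive_spart_v (fun y => sigma y ^+ 2) q h.
have h2 := is_derive_vpart_v (@d_g v h i j Vv).
have h3 := is_deriveM h1 h2.
apply: is_derive_eq h3 _.
by rewrite scaler0 addr0.
Qed.

Let christoffelE k i j : christoffel G k i j q =
  2^-1 * \sum_h warp_mx (sigma s ^+ 2)^-1 (invmx (g v)) k h *
     (D i j h + D j i h - D h i j).
Proof.
rewrite /christoffel GE // invmx_warp_mx //; last exact: g_unit.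
by rewrite unitfE expf_neq0 // sigma_neq0.
Qed.

Let s0 : sigma s != 0. Proof. exact: sigma_neq0. Qed.
Let gig : invmx (g v) *m g v = 1%:M. Proof. by rewrite mulVmx // g_unit. Qed.
Let gC i j : g v i j = g v j i. Proof. exact: g_sym. Qed.

Lemma warped_christoffel :
  [/\ christoffel G ord0 ord0 ord0 q = 0,
      forall j, christoffel G ord0 ord0 (l j) q = 0,
      forall i, christoffel G ord0 (l i) ord0 q = 0 &
      forall i j, christoffel G ord0 (l i) (l j) q =
        - (sigma s * sigma' s * g v i j)] /\
  [/\ forall k, christoffel G (l k) ord0 ord0 q = 0,
      forall k j, christoffel G (l k) ord0 (l j) q = (sigma' s / sigma s) *+ (k == j),
      forall k i, christoffel G (l k) (l i) ord0 q = (sigma' s / sigma s) *+ (k == i) &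
      forall k i j, christoffel G (l k) (l i) (l j) q = christoffel g k i j v].
Proof.
split; split=> *; rewrite christoffelE.
- exact: warped_Gam000.
- exact: warped_Gam00j.
- exact: warped_Gam0i0.
- exact: warped_Gam0ij.
- exact: warped_Gamk00.
- exact: (warped_Gamk0j s0 gig).
- exact: (warped_Gamki0 s0 gig).
- exact: (warped_Gamkij _ s0 Dlll).
Qed.

End at_point.

Let christoffel_gC v k i j : V v -> christoffel g k i j v = christoffel g k j i v.
Proof.
move=> Vv; rewrite /christoffel; congr (_ * _); apply: eq_bigr => h _.
congr (_ * _); rewrite [X in X - _]addrC; congr (_ - _).
by apply: (eq_partial oV _ _ Vv) => x Vx; exact: g_sym.
Qed.

Let d_b s : I s -> is_derive s (1 : R) (fun y => sigma y * sigma' y)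
  (sigma' s ^+ 2 + sigma s * sigma'' s).
Proof.
move=> Is; apply: is_derive_eq (is_deriveM (d_sigma_s Is) (d_sigma'_s Is)) _.
by rewrite addrC expr2.
Qed.

Let d_r s : I s -> is_derive s (1 : R) (fun y => sigma' y / sigma y)
  (sigma'' s / sigma s - (sigma' s / sigma s) ^+ 2).
Proof.
move=> Is; have s0 := sigma_neq0 Is.
apply: is_derive_eq (is_deriveM (d_sigma'_s Is) (is_derive_inv s0 (d_sigma_s Is))) _.
by rewrite /GRing.scale /=; field.
Qed.

Let d_spart q (F : R -> R) d : is_derive (spart q) (1 : R) F d ->
  is_derive q (delta_mx 0 ord0) (F \o @spart R m) d.
Proof.
by move=> [dF dFE]; have := is_derive_spart_s dF; rewrite derive1E dFE.
Qed.

Let d_delta q h (F : 'rV[R]_m.+1 -> R) d (b : bool) :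
  is_derive q (delta_mx 0 h) F d ->
  is_derive q (delta_mx 0 h) (fun x => F x *+ b) (d *+ b).
Proof. by case: b => // _; exact: is_derive_cst. Qed.

(** The formulas of [warped_christoffel] hold at every point of the open set [U], so they can be
    differentiated there; the result is fed to the algebra of [warped_ric00] and its companions. *)
Lemma ricci_warped q : U q -> let s := spart q in let v := vpart q in
  [/\ ricci G q ord0 ord0 = - (m%:R * (sigma'' s / sigma s)),
      forall j, ricci G q ord0 (l j) = 0,
      forall j, ricci G q (l j) ord0 = 0 &
      forall i j, ricci G q (l i) (l j) =
        ricci g v i j + ((1 - m%:R) * sigma' s ^+ 2 - sigma s * sigma'' s) * g v i j].
Proof.
move=> Uq s v; have [Is Vv] := Uq.
have [[G000 G00j G0i0 G0ij] [Gk00 Gk0j Gki0 Gkij]] := warped_christoffel Uq.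
pose dGam h k i j := partial h (christoffel G k i j) q.
have W x : U x -> _ := @warped_christoffel x.
have dG00j h j : dGam h ord0 ord0 j = 0.
  apply: partial0 => // x /W[[W1 W2 _ _] _].
  by case: (unliftP ord0 j) => [k|] ->.
have dG0i0 h i : dGam h ord0 i ord0 = 0.
  apply: partial0 => // x /W[[W1 _ W2 _] _].
  by case: (unliftP ord0 i) => [k|] ->.
have dG0ij i j : dGam ord0 ord0 (l i) (l j) =
    - ((sigma' s ^+ 2 + sigma s * sigma'' s) * g v i j).
  apply: (partial_eq (F' := - (((fun y => sigma y * sigma' y) \o @spart R m)
                   * ((fun y => g y i j) \o @vpart R m)))) => //.
    by move=> x /W[[_ _ _ ->] _].
  apply: is_derive_eq (is_deriveN (is_deriveM (d_spart (d_b Is))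
    (is_derive_vpart_s (fun y => g y i j) q))) _.
  by rewrite scaler0 add0r; congr (- _); rewrite /GRing.scale /= mulrC.
have dGk00 h k : dGam h (l k) ord0 ord0 = 0.
  by apply: partial0 => // x /W[_ [->]].
have W0j x k j : U x -> christoffel G (l k) ord0 (l j) x =
    ((fun y => sigma' y / sigma y) \o @spart R m) x *+ (k == j).
  by move=> /W[_ [_ ->]].
have Wi0 x k j : U x -> christoffel G (l k) (l j) ord0 x =
    ((fun y => sigma' y / sigma y) \o @spart R m) x *+ (k == j).
  by move=> /W[_ [_ _ ->]].
have Wij x k i j : U x -> christoffel G (l k) (l i) (l j) x =
    (christoffel g k i j \o @vpart R m) x.
  by move=> /W[_ [_ _ _ ->]].
have d0Gk0j k j : dGam ord0 (l k) ord0 (l j) =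
    (sigma'' s / sigma s - (sigma' s / sigma s) ^+ 2) *+ (k == j).
  apply: (partial_eq (fun x => @W0j x k j)) => //.
  by apply: d_delta; exact: d_spart (d_r Is).
have dlGk0j h k j : dGam (l h) (l k) ord0 (l j) = 0.
  apply: (partial_eq (fun x => @W0j x k j)) => //.
  rewrite -(mul0rn R (k == j)).
  by apply: d_delta; exact: is_derive_spart_v.
have dlGki0 h k j : dGam (l h) (l k) (l j) ord0 = 0.
  apply: (partial_eq (fun x => @Wi0 x k j)) => //.
  rewrite -(mul0rn R (k == j)).
  by apply: d_delta; exact: is_derive_spart_v.
have d0Gkij k i j : dGam ord0 (l k) (l i) (l j) = 0.
  apply: (partial_eq (fun x => @Wij x k i j)) => //.
  exact: is_derive_vpart_s.
have dlGkij h k i j : dGam (l h) (l k) (l i) (l j) =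
    partial h (christoffel g k i j) v.
  apply: etrans (eq_partial oU (fun x => @Wij x k i j) (l h) Uq) _.
  exact: partial_vpart.
have cC k i j := christoffel_gC k i j Vv.
pose Gam k i j := christoffel G k i j q.
have gC i j : g v i j = g v j i by exact: g_sym.
split=> *; rewrite mxE.
- apply: etrans (@warped_ric00 _ _ Gam dGam _ _ G000 G00j Gk00 Gk0j dG00j dGk00 d0Gk0j) _.
  by congr (- (_ * _)); rewrite subrK.
- exact: (@warped_ric0j _ _ Gam dGam (fun k i j => christoffel g k i j v) _
    G000 G00j G0i0 Gk00 Gk0j Gkij dG00j dlGk0j cC).
- exact: (@warped_ricj0 _ _ Gam dGam (fun k i j => christoffel g k i j v) _
    G000 G00j G0i0 Gk00 Gk0j Gki0 Gkij dG0i0 dlGki0 d0Gkij cC).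
- apply: etrans (@warped_ricij _ _ Gam dGam (fun k i j => christoffel g k i j v)
    (fun h k i j => partial h (christoffel g k i j) v) (g v) _ _ _
    G000 G00j G0i0 G0ij Gki0 Gkij dG0i0 dG0ij dlGkij gC _ _) _.
  rewrite [in RHS]mxE addrC; congr (_ + _ * _); have := sigma_neq0 Is => s0.
  by rewrite -/s; field.
Qed.

(** For a function of s alone only the symbols with upper index [ord0] enter, and the only nonzero
    ones are [- sigma * sigma' * g i j]. *)
Lemma hessian_warped F q : (forall s, I s -> derivable F s 1) ->
  (forall s, I s -> derivable F^`()%classic s 1) -> forall H,
  (forall q, U q -> H q = F (spart q)) ->
  U q -> let s := spart q in
  [/\ hessian G H q ord0 ord0 = F^`(2)%classic s,
      forall j, hessian G H q ord0 (l j) = 0,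
      forall j, hessian G H q (l j) ord0 = 0 &
      forall i j, hessian G H q (l i) (l j) =
        sigma s * sigma' s * F^`()%classic s * g (vpart q) i j].
Proof.
move=> dF d2F H HE Uq s; have [Is Vv] := Uq.
have [[G000 G00j G0i0 G0ij] [Gk00 Gk0j Gki0 Gkij]] := warped_christoffel Uq.
have d_s (K : R -> R) x : derivable K (spart x) 1 ->
    is_derive x (delta_mx 0 ord0) (K \o @spart R m) (K^`()%classic (spart x)).
  exact: is_derive_spart_s.
have HE' x : U x -> H x = (F \o @spart R m) x by exact: HE.
have H0 x : U x -> partial ord0 H x = (F^`()%classic \o @spart R m) x.
  by move=> Ux; apply: (partial_eq HE' Ux); apply/d_s/dF; case: Ux.
have Hl j x : U x -> partial (l j) H x = 0.
  by move=> Ux; apply: (partial_eq HE' Ux); exact: is_derive_spart_v.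
have SE i j : \sum_k christoffel G k i j q * partial k H q =
    christoffel G ord0 i j q * F^`()%classic s.
  rewrite big_ord_recl H0 // big1 ?addr0 // => k _.
  by rewrite Hl ?mulr0.
split=> *; rewrite mxE SE ?(G000, G00j, G0i0, G0ij).
- rewrite mul0r subr0; apply: (partial_eq H0 Uq).
  by apply: d_s; exact: d2F.
- by rewrite mul0r subr0; apply: (partial0 _ (Hl _) Uq).
- rewrite mul0r subr0; apply: (partial_eq H0 Uq).
  exact: is_derive_spart_v.
- rewrite (partial0 _ (Hl _) Uq) sub0r mulNr opprK.
  by rewrite mulrAC.
Qed.

Lemma differential_warped F q : (forall s, I s -> derivable F s 1) -> forall H,
  (forall q, U q -> H q = F (spart q)) -> U q ->
  differential H q = F^`()%classic (spart q) *: delta_mx 0 ord0.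
Proof.
move=> dF H HE Uq; have [Is Vv] := Uq.
apply/rowP => i; rewrite !mxE eqxx /=.
case: (unliftP ord0 i) => [j|] ->.
  rewrite mulr0; apply: (partial_eq HE Uq); exact: (is_derive_spart_v F).
rewrite mulr1; apply: (partial_eq HE Uq).
exact/(is_derive_spart_s (F := F))/dF.
Qed.

Lemma gradient_warped F q : (forall s, I s -> derivable F s 1) -> forall H,
  (forall q, U q -> H q = F (spart q)) -> U q ->
  gradient G H q = F^`()%classic (spart q) *: delta_mx 0 ord0.
Proof.
move=> dF H HE Uq; have [Is Vv] := Uq.
rewrite /gradient (differential_warped dF HE Uq) -scalemxAl; congr (_ *: _).
rewrite GE // invmx_warp_mx ?g_unit //; last by rewrite unitfE expf_neq0 // sigma_neq0.
rewrite -rowE; apply/rowP => j; rewrite !mxE unlift_none eqxx /=.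
by case: (unliftP ord0 j) => [k|] ->; rewrite ?liftK ?unlift_none.
Qed.

End warped_product_geometry.

(* M = n - 1; [f0], [f1], [f2] are f, f', f'' at h; [sg] is sigma and [z''] is
   the second derivative of zeta. *)
Section equations.
Variables (R : fieldType) (M lam alpha mu th th' w sg sg' sg'' z'' f0 f1 f2 : R).
Hypotheses (w0 : w != 0) (sg0 : sg != 0) (f00 : f0 != 0).
Hypothesis wE : w ^+ 2 = 1 - th ^+ 2.
Hypothesis sg'E : sg' = f1 / f0 * w * sg + th.
Hypothesis sg''E : sg'' =
  f2 / f0 * w ^+ 2 * sg + f1 / f0 * z'' * sg + f1 / f0 * w * th + th'.
Hypothesis z''E : z'' = - (th * th' / w).

(** Once [1 - th ^+ 2] is replaced by [w ^+ 2], inserting [sg''] and [z''] makes the two expressions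
    for [lam] identical as rational functions. *)
Lemma radial_equation P :
  - (M * (sg'' / sg)) - alpha * P + z'' - mu * w ^+ 2 = lam <->
  lam = - (M + 1 - 1) * (1 - th ^+ 2) * (f2 / f0)
        - (M + 1 - 1) * th * (w / sg) * (f1 / f0)
        + ((M + 1 - 1) * (th * (f1 / f0) - w / sg) - th) * (th' / w)
        - alpha * P - mu * (1 - th ^+ 2).
Proof.
rewrite -wE.
suff -> : - (M * (sg'' / sg)) - alpha * P + z'' - mu * w ^+ 2 =
    - (M + 1 - 1) * w ^+ 2 * (f2 / f0) - (M + 1 - 1) * th * (w / sg) * (f1 / f0)
    + ((M + 1 - 1) * (th * (f1 / f0) - w / sg) - th) * (th' / w)
    - alpha * P - mu * w ^+ 2 by split.
by rewrite sg''E z''E; field; rewrite w0 sg0 f00.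
Qed.

(** The component equation is [sg ^+ 2 * e] times the scalar one, up to sign and order of the terms;
    this factor is nonzero, so the two are equivalent. *)
Lemma spherical_equation e P : e != 0 ->
  (M - 1) * e + ((1 - M) * sg' ^+ 2 - sg * sg'') * e - alpha * P + sg * sg' * w * e
    = lam * (sg ^+ 2 * e) <->
  lam - f1 / f0 - th * (w / sg - f1 / f0 * th) =
    (M + 1 - 2) * (w / sg - f1 / f0 * th) ^+ 2
    - (1 - th ^+ 2) * (f2 / f0 - (f1 / f0) ^+ 2)
    + (th ^+ 2 - (M + 1 - 1)) * (f1 / f0) ^+ 2
    - f1 / f0 * th * (w / sg) - th' / sg + th' / w * (f1 / f0) * th
    - alpha * (P / e / sg ^+ 2).
Proof.
move=> e0.
set A := (X in X = _ <-> _); set B := (X in _ = X <-> _).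
set C := (X in _ <-> X = _); set D := (X in _ <-> _ = X).
suff E : A - B = (D - C) * (sg ^+ 2 * e).
  have se0 : sg ^+ 2 * e != 0 by rewrite mulf_neq0 // expf_neq0.
  split=> [AB|CD].
    move/eqP: E; rewrite AB subrr eq_sym mulf_eq0 (negbTE se0) orbF subr_eq0.
    by move/eqP.
  by apply/eqP; rewrite -subr_eq0 E CD subrr mul0r.
(* The proportionality is no rational identity, since it uses [w ^+ 2 = 1 - th ^+ 2]. The extra
   summand is the multiple of [w ^+ 2 - (1 - th ^+ 2)] by which the two sides differ before that
   relation is imposed. *)
have {1}-> : A - B = (D - C) * (sg ^+ 2 * e) +
    (w ^+ 2 - (1 - th ^+ 2)) * ((- (M - 1) * (1 / sg ^+ 2 + (f1 / f0) ^+ 2)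
     - f2 / f0 + f1 / f0) * (sg ^+ 2 * e)).
  by rewrite /A /B /C /D sg'E sg''E z''E; field; rewrite w0 e0 sg0 f00.
by rewrite wE subrr mul0r addr0.
Qed.

End equations.

(** * Rotational hypersurfaces *)

Section profile_derivatives.
Context {R : realType}.
Variables (I : set R) (f zeta beta : R -> R).
Hypothesis oI : open I.
Hypothesis sf : smooth_on_line setT f.
Hypothesis sz : smooth_on_line I zeta.
Hypothesis sb : smooth_on_line I beta.
Hypothesis f_gt0 : forall t, 0 < f t.
Hypothesis zeta_deriv : forall s, I s ->
  zeta^`()%classic s = Num.sqrt (1 - angle f zeta beta s ^+ 2).
Hypothesis angle_lt1 : forall s, I s -> `|angle f zeta beta s| < 1.
Let theta := angle f zeta beta.
Let sigma := parallel_radius f zeta beta.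

Let dsm (A : set R) (F : R -> R) k s : smooth_on_line A F -> A s ->
  is_derive s (1 : R) (F^`(k)%classic) (F^`(k.+1)%classic s).
Proof. by move=> sF As; rewrite derive1nS derive1E; apply/derivableP/sF. Qed.

Let scaleRE (a b : R) : a *: b = a * b.
Proof. by []. Qed.

Lemma is_derive_warp_zeta k s : I s ->
  is_derive s (1 : R) (f^`(k)%classic \o zeta)
    (f^`(k.+1)%classic (zeta s) * zeta^`()%classic s).
Proof.
move=> Is; apply: is_derive1_comp; first exact: (dsm k sf).
exact: (dsm 0 sz).
Qed.

Lemma is_derive_angle s : I s -> is_derive s (1 : R) theta (theta^`()%classic s).
Proof.
move=> Is; rewrite derive1E; apply/derivableP.
have h := is_deriveM (is_derive_warp_zeta 0 Is) (dsm 1 sb Is).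
exact: (ex_derive (is_derive := h)).
Qed.

Lemma angle_sqr_lt1 s : I s -> theta s ^+ 2 < 1.
Proof. by move=> Is; rewrite -real_normK ?num_real // expr_lt1 // angle_lt1. Qed.

Lemma zeta_deriv_sqr s : I s -> zeta^`()%classic s ^+ 2 = 1 - theta s ^+ 2.
Proof.
by move=> Is; rewrite zeta_deriv // sqr_sqrtr // subr_ge0 ltW // angle_sqr_lt1.
Qed.

Lemma zeta_deriv_gt0 s : I s -> 0 < zeta^`()%classic s.
Proof. by move=> Is; rewrite zeta_deriv // sqrtr_gt0 subr_gt0 angle_sqr_lt1. Qed.

(** Differentiate [zeta' ^+ 2 + theta ^+ 2 = 1], valid on all of [I], and cancel [2 * zeta']. This
    avoids differentiating the square root. *)
Lemma zeta_deriv2 s : I s ->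
  zeta^`(2)%classic s = - (theta s * theta^`()%classic s / zeta^`()%classic s).
Proof.
move=> Is; have w0 : zeta^`()%classic s != 0 by rewrite gt_eqF // zeta_deriv_gt0.
have dth := is_derive_angle Is; have dw := dsm 1 sz Is.
have [_] := is_deriveD (is_deriveX 2 dw) (is_deriveX 2 dth).
have -> : 'D_1 (zeta^`(1)%classic ^+ 2 + theta ^+ 2) s = 0.
  rewrite -(derive_cst (1 : R) s 1); apply: near_eq_derive.
  apply: near_open oI Is _ => x Ix.
  by rewrite !fctE derive1n1 zeta_deriv_sqr // subrK.
rewrite !scaleRE !expr1 derive1n1.
move: (zeta^`(2)%classic s) (theta^`()%classic s) => z'' th' /esym E.
have {}E : zeta^`()%classic s * z'' + theta s * th' = 0.
  apply: (@mulfI _ 2); first by rewrite pnatr_eq0.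
  by rewrite mulr0 -[RHS]E mulrDr; congr (_ + _); exact: mulrA.
apply: (mulfI w0); rewrite /= mulrN mulrCA divff // mulr1.
by apply/eqP; rewrite -addr_eq0 E.
Qed.

Let f1 := f^`()%classic.
(** The summand [f * beta'] is kept as [theta], so that the next differentiation yields [theta'] and
    no second derivative of [beta]. *)
Let sigma1 s := f1 (zeta s) * zeta^`()%classic s * beta s + theta s.

Lemma is_derive_radius s : I s -> is_derive s (1 : R) sigma (sigma1 s).
Proof.
move=> Is.
apply: is_derive_eq (is_deriveM (is_derive_warp_zeta 0 Is) (dsm 0 sb Is)) _.
by rewrite !scaleRE addrC mulrC.
Qed.

Lemma radius_gt0 s : 0 < beta s -> 0 < sigma s.
Proof. by move=> b0; rewrite mulr_gt0. Qed.

Lemma derive_radius s : I s -> sigma^`()%classic s = sigma1 s.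
Proof. by move=> Is; rewrite derive1E; have [_] := is_derive_radius Is. Qed.

Lemma is_derive_radius1 s : I s ->
  is_derive s (1 : R) (sigma^`()%classic)
   (f^`(2)%classic (zeta s) * zeta^`()%classic s ^+ 2 * beta s
    + f1 (zeta s) * zeta^`(2)%classic s * beta s
    + f1 (zeta s) * zeta^`()%classic s * beta^`()%classic s + theta^`()%classic s).
Proof.
(* [sigma1] is known to be the derivative of the radius only on [I], so it replaces that derivative
   near [s]. *)
move=> Is; apply: (near_eq_is_derive (f := sigma1)).
  by apply: near_open oI Is _ => x Ix; rewrite derive_radius.
have h1 := is_deriveM (is_derive_warp_zeta 1 Is) (dsm 1 sz Is).
have h2 := is_deriveD (is_deriveM h1 (dsm 0 sb Is)) (is_derive_angle Is).
apply: is_derive_eq h2 _; rewrite !scaleRE !derive1n1 !derive1n0.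
have -> : ((f^`()%classic \o zeta) * zeta^`()%classic) s =
  f1 (zeta s) * zeta^`()%classic s by [].
have -> : (f^`()%classic \o zeta) s = f1 (zeta s) by [].
move: (theta^`()%classic s) (f^`(2)%classic (zeta s)) (zeta^`(2)%classic s).
move: (zeta^`()%classic s) (beta^`()%classic s) (f1 (zeta s)) (beta s) => *.
by ring.
Qed.

Lemma derive_radius2 s : I s -> sigma^`()^`()%classic s =
   f^`(2)%classic (zeta s) * zeta^`()%classic s ^+ 2 * beta s
    + f1 (zeta s) * zeta^`(2)%classic s * beta s
    + f1 (zeta s) * zeta^`()%classic s * beta^`()%classic s + theta^`()%classic s.
Proof. by move=> Is; rewrite derive1E; have [_] := is_derive_radius1 Is. Qed.

Lemma derive_ln_warp t : (fun t => ln (f t))^`()%classic t = f1 t / f t.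
Proof.
have [_ ] := is_derive1_comp (is_derive1_ln (f_gt0 t)) (dsm 0 sf (Logic.I : setT t)).
by rewrite derive1E => ->; rewrite mulrC.
Qed.

Lemma derive2_ln_warp t : (fun t => ln (f t))^`(2)%classic t =
  f^`(2)%classic t / f t - (f1 t / f t) ^+ 2.
Proof.
have ft0 : f t != 0 by rewrite gt_eqF.
have -> : (fun t => ln (f t))^`(2)%classic t = (fun t => f1 t / f t)^`()%classic t.
  rewrite derive1nS derive1n1; congr (_^`()%classic t).
  by apply/funext => x; exact: derive_ln_warp.
have h := is_deriveM (dsm 1 sf (Logic.I : setT t))
  (is_derive_inv ft0 (dsm 0 sf (Logic.I : setT t))).
rewrite derive1E; have [_] := h => E; apply: etrans E _.
by rewrite !scaleRE !derive1n1 derive1n0 /f1; field.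
Qed.

End profile_derivatives.

(** * Charts of the hypersurface: smoothness of functions of s and the induced metric *)

Section rotational_chart.
Context {R : realType}.
Variables (m : nat) (I : set R) (V : set 'rV[R]_m) (X : 'rV[R]_m -> 'rV[R]_m.+1).
Let U : set 'rV[R]_m.+1 := [set q | I (spart q) /\ V (vpart q)].
Hypothesis oU : open U.
Let l : 'I_m -> 'I_m.+1 := lift ord0.

Lemma differentiable_spart (q : 'rV[R]_m.+1) : differentiable (@spart R m) q.
Proof. exact: differentiable_coord. Qed.

Lemma differentiable_vpart (q : 'rV[R]_m.+1) : differentiable (@vpart R m) q.
Proof.
apply: differentiable_rV => j.
have -> : (fun y : 'rV[R]_m.+1 => vpart y 0 j) = (fun y => y 0 (lift ord0 j)).
  by apply/funext => y; rewrite mxE.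
exact: differentiable_coord.
Qed.

Lemma smooth_on_spart (F : R -> R) (H : 'rV[R]_m.+1 -> R) :
  smooth_on_line I F -> (forall q, U q -> H q = F (spart q)) -> smooth_on U H.
Proof.
move=> sF HE.
(* Closed form of all iterated partials: differentiating only in s gives the derivative of [F] of
   order [size s], and a single derivative in a direction v_i makes everything vanish. *)
pose D s (q : 'rV[R]_m.+1) :=
  if all (pred1 (@ord0 m)) s then (F^`(size s)%classic \o @spart R m) q else 0.
have DE s q : U q -> foldr (@partial R m.+1) H s q = D s q.
  elim: s q => [|i s IH] q Uq; first by rewrite /D /= HE.
  have [Is _] := Uq; apply: etrans (eq_partial oU IH i Uq) _.
  rewrite /D /=; case: (all _ s); last first.
    by rewrite andbF; exact: derive_cst.
  rewrite andbT; case: (unliftP ord0 i) => [j|] ->.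
    rewrite eq_sym (negbTE (neq_lift _ _)).
    by have [_] := is_derive_spart_v (F^`(size s)%classic) q j.
  by rewrite eqxx; have [_] := is_derive_spart_s (sF (size s) _ Is).
move=> s q Uq; apply: (near_eq_differentiable (f := D s)).
  by apply: near_open oU Uq _ => x Ux; rewrite DE.
rewrite /D; case: (all _ s); last exact: differentiable_cst.
have [Is _] := Uq; have /derivable1_diffP dF := sF (size s) _ Is.
exact: (differentiable_comp (differentiable_spart q) dF).
Qed.

Variables (f zeta beta : R -> R) (Phi : 'rV[R]_m.+1 -> 'rV[R]_m.+2).
Hypothesis XP : orthogonal_sphere_param V X.
Hypothesis PhiE : forall q, U q ->
  Phi q = profile_point zeta beta (spart q) (X (vpart q)).
Hypothesis d_zeta : forall s, I s -> derivable zeta s 1.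
Hypothesis d_beta : forall s, I s -> derivable beta s 1.
Hypothesis arc_length : forall s, I s ->
  zeta^`()%classic s ^+ 2 + f (zeta s) ^+ 2 * beta^`()%classic s ^+ 2 = 1.

Let Phi0 q : U q -> Phi q 0 ord0 = (zeta \o @spart R m) q.
Proof. by move=> Uq; rewrite PhiE // mxE unlift_none. Qed.

Let Phil c q : U q -> Phi q 0 (lift ord0 c) =
  ((beta \o @spart R m) * ((fun v => X v 0 c) \o @vpart R m)) q.
Proof. by move=> Uq; rewrite PhiE // mxE liftK mxE. Qed.

Let sX : smooth_map_on V X. Proof. by case: XP. Qed.

Let dPhi q : U q -> differentiable Phi q.
Proof.
move=> Uq; have [Is Vv] := Uq; apply: differentiable_rV => j.
case: (unliftP ord0 j) => [c|] ->.
  apply: (near_eq_differentiable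
    (f := (beta \o @spart R m) * ((fun v => X v 0 c) \o @vpart R m))).
    by apply: near_open oU Uq _ => x Ux; rewrite Phil.
  have /derivable1_diffP db := d_beta Is.
  exact: (differentiableM (differentiable_comp (differentiable_spart q) db)
    (differentiable_comp (differentiable_vpart q) (sX c [::] Vv))).
apply: (near_eq_differentiable (f := zeta \o @spart R m)).
  by apply: near_open oU Uq _ => x Ux; rewrite Phi0.
have /derivable1_diffP dz := d_zeta Is.
exact: (differentiable_comp (differentiable_spart q) dz).
Qed.

Let partial_eq (F F' : 'rV[R]_m.+1 -> R) h q d : (forall q, U q -> F q = F' q) -> U q ->
  is_derive q (delta_mx 0 h) F' d -> partial h F q = d.
Proof. by move=> FF Uq [_ <-]; exact: (eq_partial oU FF). Qed.

(** The mixed entries vanish because each [X_i] is orthogonal to [X], and the radial entry is the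
    arc length condition because [X] has length one. *)
Lemma pullback_rotational q : U q ->
  pullback (warped_metric f) Phi q =
  warp_mx (parallel_radius f zeta beta (spart q) ^+ 2) (sphere_metric X (vpart q)).
Proof.
move=> Uq; have [Is Vv] := Uq; set s := spart q; set v := vpart q.
have J00 : ('J Phi q) ord0 ord0 = zeta^`()%classic s.
  rewrite jacobianE; last exact: dPhi.
  by apply: (partial_eq Phi0 Uq); exact/is_derive_spart_s/d_zeta.
have Jl0 i : ('J Phi q) (l i) ord0 = 0.
  rewrite jacobianE; last exact: dPhi.
  by apply: (partial_eq Phi0 Uq); exact: is_derive_spart_v.
have J0l c : ('J Phi q) ord0 (lift ord0 c) = beta^`()%classic s * X v 0 c.
  rewrite jacobianE; last exact: dPhi.
  apply: (partial_eq (Phil c) Uq).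
  have h1 := is_derive_spart_s (d_beta Is).
  have h2 := is_derive_vpart_s (fun v => X v 0 c) q.
  by apply: is_derive_eq (is_deriveM h1 h2) _; rewrite scaler0 add0r; exact: mulrC.
have Jll i c : ('J Phi q) (l i) (lift ord0 c) = beta s * tpartial i X v 0 c.
  rewrite jacobianE; last exact: dPhi.
  apply: (partial_eq (Phil c) Uq).
  have h1 := is_derive_spart_v beta q i.
  have dXc : derivable (fun y => X y 0 c) v (delta_mx 0 i).
    exact/diff_derivable/(sX c [::]).
  have h2 := is_derive_vpart_v dXc.
  apply: is_derive_eq (is_deriveM h1 h2) _; rewrite scaler0 addr0.
  by rewrite (tpartialE _ _ sX Vv).
have XX : eucl_dot (X v) (X v) = 1 by case: XP => _ _ _ /(_ v Vv)[].
have TX i := @sphere_param_normal _ _ _ _ XP (fun i => tpartial i X) (fun=> erefl) v i Vv.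
have entry i j : pullback (warped_metric f) Phi q i j =
    'J Phi q i ord0 * 'J Phi q j ord0 +
    f (zeta s) ^+ 2 * \sum_c 'J Phi q i (lift ord0 c) * 'J Phi q j (lift ord0 c).
  rewrite /pullback /warped_metric [LHS]mxE big_ord_recl mul_mx_diag.
  rewrite !mxE unlift_none mulr1; congr (_ + _).
  rewrite mulr_sumr; apply: eq_bigr => c _; rewrite !mxE liftK mxE.
  have -> : Phi q 0 0 = zeta s by exact: Phi0.
  by rewrite [X in X * _ = _]mulrC mulrA.
apply/matrixP => i j; rewrite entry.
case: (unliftP ord0 i) => [i'|] ->; case: (unliftP ord0 j) => [j'|] ->;
  rewrite !warp_mxE !(J00, Jl0) ?mul0r ?mulr0 ?add0r.
- have -> : sphere_metric X v i' j' =
      \sum_c tpartial i' X v 0 c * tpartial j' X v 0 c by rewrite mxE.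
  rewrite /parallel_radius exprMn -[RHS]mulrA; congr (_ * _); rewrite mulr_sumr.
  by apply: eq_bigr => c _; rewrite !Jll mulrACA.
- apply/eqP; rewrite mulf_eq0; apply/orP; right; apply/eqP.
  rewrite -[RHS](mulr0 (beta s * beta^`()%classic s)) -[in RHS](TX i') mulr_sumr.
  by apply: eq_bigr => c _; rewrite Jll J0l mulrACA.
- apply/eqP; rewrite mulf_eq0; apply/orP; right; apply/eqP.
  rewrite -[RHS](mulr0 (beta s * beta^`()%classic s)) -[in RHS](TX j') mulr_sumr.
  by apply: eq_bigr => c _; rewrite Jll J0l mulrC mulrACA.
- rewrite -[RHS](arc_length Is) expr2; congr (_ + _ * _).
  rewrite -[RHS]mulr1 -XX mulr_sumr.
  by apply: eq_bigr => c _; rewrite !J0l expr2 mulrACA.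
Qed.

End rotational_chart.

(** * The Einstein-type equation *)

Lemma metric_dot_mul (R : realType) n k (G : 'M[R]_k) (J : 'M[R]_(n, k)) (v w : 'rV[R]_n) :
  metric_dot G (v *m J) (w *m J) = (v *m (J *m G *m J^T) *m w^T) 0 0.
Proof. by rewrite /metric_dot trmx_mul !mulmxA. Qed.

Lemma delta_form (R : realType) n (P : 'M[R]_n) i j (c d : R) :
  ((c *: delta_mx 0 i : 'rV[R]_n) *m P *m (d *: delta_mx 0 j : 'rV[R]_n)^T) 0 0
  = c * d * P i j.
Proof.
rewrite -!scalemxAl -rowE linearZ /= -scalemxAr trmx_delta -colE !mxE.
by rewrite mulrA.
Qed.

Lemma height_param (R : realType) m (S : rmanifold R m.+1) f t0 t1 zeta beta
    (phi : S -> 'rV[R]_m.+2) V X (a : chart S) q :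
  rotational_hypersurface f t0 t1 zeta beta phi V X -> dom a q ->
  height phi (param a q) = zeta (spart q).
Proof.
by move=> H aq; rewrite /height (rot_param H aq) mxE unlift_none.
Qed.

Section einstein_equation.
Variables (R : realType) (m : nat) (Ric Hess P : 'M[R]_m.+1) (e : 'M[R]_m).
Variables (alpha mu lam w sg A B C D : R).
Let l : 'I_m -> 'I_m.+1 := lift ord0.
Hypothesis alpha0 : alpha != 0.
Hypothesis Psym : forall i j, P i j = P j i.
Hypothesis e0 : forall i j, i != j -> e i j = 0.
Hypothesis Ric00 : Ric ord0 ord0 = A.
Hypothesis Ric0j : forall j, Ric ord0 (l j) = 0.
Hypothesis Ricj0 : forall j, Ric (l j) ord0 = 0.
Hypothesis Ricij : forall i j, Ric (l i) (l j) = B * e i j.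
Hypothesis Hess00 : Hess ord0 ord0 = C.
Hypothesis Hess0j : forall j, Hess ord0 (l j) = 0.
Hypothesis Hessj0 : forall j, Hess (l j) ord0 = 0.
Hypothesis Hessij : forall i j, Hess (l i) (l j) = D * e i j.
Let dh : 'rV[R]_m.+1 := w *: delta_mx 0 ord0.

(** [A] and [C] are the radial entries of Ricci tensor and Hessian, [B] and [D] their coefficients
    along [e]. Off the diagonal only [- alpha * P] is left, and [alpha] can be cancelled; [Psym]
    recovers the column below the radial entry from the row beside it. *)
Lemma einstein_entries :
  Ric - alpha *: P + Hess - mu *: (dh^T *m dh) = lam *: warp_mx (sg ^+ 2) e <->
  [/\ A - alpha * P ord0 ord0 + C - mu * w ^+ 2 = lam,
      forall i, B * e i i - alpha * P (l i) (l i) + D * e i i = lam * (sg ^+ 2 * e i i),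
      forall i, P ord0 (l i) = 0 &
      forall i j, i != j -> P (l i) (l j) = 0].
Proof.
have dh0 : dh 0 ord0 = w by rewrite !mxE eqxx mulr1.
have dhl i : dh 0 (l i) = 0.
  by rewrite !mxE eqxx /= mulr0.
have entry i j : (Ric - alpha *: P + Hess - mu *: (dh^T *m dh)) i j =
    Ric i j - alpha * P i j + Hess i j - mu * (dh 0 i * dh 0 j).
  move: (dh) => d; rewrite !mxE big_ord_recl big_ord0 addr0.
  by rewrite !mxE; congr (_ - _ * (_ * _)); congr (d _ _); rewrite ord1.
have entryR i j : (lam *: warp_mx (sg ^+ 2) e) i j = lam * warp_mx (sg ^+ 2) e i j.
  by rewrite mxE.
split=> [E|[E00 Eii E0i Eij]].
  have Ee i j : Ric i j - alpha * P i j + Hess i j - mu * (dh 0 i * dh 0 j) =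
      lam * warp_mx (sg ^+ 2) e i j by rewrite -entry E entryR.
  split=> [|i|i|i j ij].
  - by have := Ee ord0 ord0; rewrite Ric00 Hess00 dh0 -expr2 warp_mx00 mulr1.
  - have := Ee (l i) (l i).
    by rewrite Ricij Hessij dhl mul0r mulr0 subr0 warp_mxll.
  - have := Ee ord0 (l i).
    rewrite Ric0j Hess0j dhl !mulr0 subr0 warp_mx0l mulr0 addr0 sub0r => /eqP.
    by rewrite oppr_eq0 mulf_eq0 (negbTE alpha0) => /eqP.
  - have := Ee (l i) (l j).
    rewrite Ricij Hessij dhl mul0r mulr0 subr0 warp_mxll e0 // !mulr0 addr0 sub0r.
    by move/eqP; rewrite oppr_eq0 mulf_eq0 (negbTE alpha0) => /eqP.
apply/matrixP => i j; rewrite entry entryR.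
case: (unliftP ord0 i) => [i'|] ->; case: (unliftP ord0 j) => [j'|] ->.
- rewrite Ricij Hessij !dhl mul0r mulr0 subr0 warp_mxll.
  have [->|ij] := eqVneq i' j'; first exact: Eii.
  by rewrite e0 // !mulr0 Eij // mulr0 subr0 addr0.
- by rewrite Ricj0 Hessj0 dhl mul0r mulr0 subr0 warp_mxl0 Psym E0i !mulr0 subr0 addr0.
- by rewrite Ric0j Hess0j dhl !mulr0 subr0 warp_mx0l E0i !mulr0 subr0 addr0.
- by rewrite Ric00 Hess00 dh0 -expr2 warp_mx00 mulr1.
Qed.

End einstein_equation.

(** * Ricci tensor, Hessian and gradient of the height in a chart of the hypersurface *)

Section rotational_hypersurface_geometry.
Variables (R : realType) (m : nat) (S : rmanifold R m.+1).
Variables (f : R -> R) (t0 t1 : \bar R) (zeta beta : R -> R).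
Variables (phi : S -> 'rV[R]_m.+2).
Variables (V : chart S -> set 'rV[R]_m) (X : chart S -> 'rV[R]_m -> 'rV[R]_m.+1).
Hypothesis H : rotational_hypersurface f t0 t1 zeta beta phi V X.
Variable a : chart S.

Let I : set R := [set s | (t0 < s%:E)%E /\ (s%:E < t1)%E].
Let U : set 'rV[R]_m.+1 := [set q | I (spart q) /\ V a (vpart q)].
Let sigma := parallel_radius f zeta beta.
Let sigma' := sigma^`()%classic.
Let sigma'' := sigma'^`()%classic.
Let e := sphere_metric (X a).
Let l : 'I_m -> 'I_m.+1 := lift ord0.

Lemma rot_open_interval : open I.
Proof. by apply: openI; [exact: open_ereal_gt|exact: open_ereal_lt]. Qed.

Lemma rot_domE : dom a = U.
Proof.
rewrite (rot_dom H); apply/seteqP; split=> q /=; first by case.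
by case=> -[].
Qed.

Let oU : open U. Proof. by rewrite -rot_domE; exact: dom_open. Qed.

Lemma rot_smooth_height : smooth_on (dom a) (read (height phi) a).
Proof.
rewrite rot_domE; apply: (smooth_on_spart oU (rot_zeta_smooth H)) => q Uq.
by rewrite /read (height_param H) // rot_domE.
Qed.

Let XP : orthogonal_sphere_param (V a) (X a). Proof. exact: rot_sphere_param H a. Qed.
Let oV : open (V a). Proof. by case: XP. Qed.

Lemma rot_metricE q : U q -> metric a q = warp_mx (sigma (spart q) ^+ 2) (e (vpart q)).
Proof.
move=> Uq; rewrite (rot_metric H) ?rot_domE //.
apply: (pullback_rotational oU XP _ _ _ _ Uq).
- by move=> x Ux; rewrite (rot_param H) // rot_domE.
- exact: (rot_zeta_smooth H (k := 0%N)).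
- exact: (rot_beta_smooth H (k := 0%N)).
- by move=> s [s0 s1]; exact: (rot_arc_length H s0 s1).
Qed.

Let sigma_neq0 s : I s -> sigma s != 0.
Proof.
by move=> [s0 s1]; rewrite gt_eqF // radius_gt0 ?(rot_beta_pos H) //; exact: rot_warp_pos H.
Qed.

Let d_sigma s : I s -> derivable sigma s 1.
Proof.
move=> Is; have h := is_derive_radius (rot_warp_smooth H) (rot_zeta_smooth H)
  (rot_beta_smooth H) Is.
exact: (ex_derive (is_derive := h)).
Qed.

Let d_sigma' s : I s -> derivable sigma' s 1.
Proof.
move=> Is; have h := is_derive_radius1 rot_open_interval (rot_warp_smooth H)
  (rot_zeta_smooth H) (rot_beta_smooth H) Is.
exact: (ex_derive (is_derive := h)).
Qed.

Let T i := tpartial i (X a).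
Let TT i j := tpartial i (T j).
Let TE i : T i = tpartial i (X a). Proof. by []. Qed.
Let TTE i j : TT i j = tpartial i (T j). Proof. by []. Qed.

Let e_sym v i j : V a v -> e v i j = e v j i.
Proof. by move=> _; rewrite !mxE; exact: eucl_dotC. Qed.

Let e_unit v : V a v -> e v \in unitmx.
Proof. exact: (sphere_metric_unit XP TE). Qed.

Let d_e v h i j : V a v -> derivable (fun x => e x i j) v (delta_mx 0 h).
Proof.
move=> Vv; have d := is_derive_sphere_metric XP TE TTE h i j Vv.
exact: (ex_derive (is_derive := d)).
Qed.

Lemma rot_ricci q : U q -> let s := spart q in let v := vpart q in
  [/\ ricci (metric a) q ord0 ord0 = - (m%:R * (sigma'' s / sigma s)),
      forall j, ricci (metric a) q ord0 (l j) = 0,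
      forall j, ricci (metric a) q (l j) ord0 = 0 &
      forall i j, ricci (metric a) q (l i) (l j) =
        ((m%:R - 1) + ((1 - m%:R) * sigma' s ^+ 2 - sigma s * sigma'' s)) * e v i j].
Proof.
move=> Uq s v; have [Is Vv] := Uq.
have [R00 R0j Rj0 Rij] := ricci_warped oU oV sigma_neq0 d_sigma d_sigma'
  e_sym e_unit d_e rot_metricE Uq.
split=> // i j; rewrite Rij [RHS]mulrDl; congr (_ + _).
by rewrite (ricci_sphere XP TE TTE Vv) mxE.
Qed.

Let d_zeta s : I s -> derivable zeta s 1.
Proof. exact: (rot_zeta_smooth H (k := 0%N)). Qed.

Let d2_zeta s : I s -> derivable zeta^`()%classic s 1.
Proof. exact: (rot_zeta_smooth H (k := 1%N)). Qed.

Let readE q : U q -> read (height phi) a q = zeta (spart q).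
Proof. by move=> Uq; rewrite /read (height_param H) // rot_domE. Qed.

Lemma rot_hessian q : U q -> let s := spart q in
  let hess := hessian (metric a) (read (height phi) a) q in
  [/\ hess ord0 ord0 = zeta^`(2)%classic s, forall j, hess ord0 (l j) = 0,
      forall j, hess (l j) ord0 = 0 &
      forall i j, hess (l i) (l j) =
        sigma s * sigma' s * zeta^`()%classic s * e (vpart q) i j].
Proof.
exact: (hessian_warped oU sigma_neq0 d_sigma
  e_sym e_unit d_e rot_metricE d_zeta d2_zeta readE).
Qed.

Lemma rot_differential q : U q -> differential (read (height phi) a) q =
  zeta^`()%classic (spart q) *: delta_mx 0 ord0.
Proof. exact: (differential_warped oU d_zeta readE). Qed.

Lemma rot_gradient q : U q -> gradient (metric a) (read (height phi) a) q =
  zeta^`()%classic (spart q) *: delta_mx 0 ord0.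
Proof. exact: (gradient_warped oU sigma_neq0 e_unit rot_metricE d_zeta readE). Qed.

End rotational_hypersurface_geometry.

Theorem theorem5p1 (R : realType) (m p : nat)
  (S : rmanifold R m.+1) (N : rmanifold R p)
  (f : R -> R) (t0 t1 : \bar R) (zeta beta : R -> R)
  (phi : S -> 'rV[R]_m.+2)
  (V : chart S -> set 'rV[R]_m) (X : chart S -> 'rV[R]_m -> 'rV[R]_m.+1)
  (alpha : R) (u : S -> N) (mu lambda : S -> R) :
  rotational_hypersurface f t0 t1 zeta beta phi V X ->
  (forall s, (t0 < s%:E)%E -> (s%:E < t1)%E -> `|angle f zeta beta s| < 1) ->
  0 < alpha -> smooth_map u -> smooth_fun mu -> smooth_fun lambda ->
  einstein_type (height phi) alpha u mu lambda
  <->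
  (forall (a : chart S) (b : chart N) (q : 'rV[R]_m.+1), rep_dom u a b q ->
    let x := param a q in
    let s := spart q in
    let n : R := m.+1%:R in
    let h := height phi x in
    let theta := angle f zeta beta s in
    let theta' := derive1 (angle f zeta beta) s in
    let w := Num.sqrt (1 - theta ^+ 2) in
    let sigma := parallel_radius f zeta beta s in
    let logf := fun t => ln (f t) in
    let du (v : 'rV[R]_m.+1) := v *m 'J (local_rep u a b) q in
    let phi_s := frame_s m in
    let phi_v := frame_v (X a) q in
    let dotN := metric_dot (metric b (local_rep u a b q)) in
    let tau := tension (metric a) (metric b) (local_rep u a b) q in
    [/\ lambda x =
          - (n - 1) * (1 - theta ^+ 2) * (derive1n 2 f h / f h)
          - (n - 1) * theta * (w / sigma) * derive1 logf h
          + ((n - 1) * (theta * derive1 logf h - w / sigma) - theta) * (theta' / w)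
          - alpha * (dotN tau tau / (1 - theta ^+ 2))
          - mu x * (1 - theta ^+ 2),
        forall i : 'I_m,
          lambda x - derive1 f h / f h
          - theta * (w / sigma - derive1 f h / f h * theta) =
          (n - 2) * (w / sigma - derive1 f h / f h * theta) ^+ 2
          - (1 - theta ^+ 2) * derive1n 2 logf h
          + (theta ^+ 2 - (n - 1)) * derive1 logf h ^+ 2
          - derive1 f h / f h * theta * (w / sigma)
          - theta' / sigma
          + theta' / w * (derive1 f h / f h) * theta
          - alpha * (dotN (du (phi_v i)) (du (phi_v i)) / sigma ^+ 2),
        forall i : 'I_m, dotN (du phi_s) (du (phi_v i)) = 0,
        forall i j : 'I_m, i != j -> dotN (du (phi_v i)) (du (phi_v j)) = 0
      & tau = w *: du phi_s]).
Proof.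
move=> H angle1 alpha0 su smu slam.
have forall_iff (T : Type) (P Q : T -> Prop) :
    (forall x, P x <-> Q x) -> (forall x, P x) <-> (forall x, Q x).
  by move=> PQ; split=> K x; exact/PQ.
(* Positivity and smoothness of the data are assumed, except for the height, where
   [rot_smooth_height] supplies it. What remains on both sides is a statement at each [a], [b], [q],
   so the equivalence can be proved pointwise. *)
have einsteinE : einstein_type (height phi) alpha u mu lambda <->
    forall (a : chart S) (b : chart N) q, rep_dom u a b q ->
    ricci (metric a) q - alpha *: pullback (metric b) (local_rep u a b) q
       + hessian (metric a) (read (height phi) a) q
       - mu (param a q) *: ((differential (read (height phi) a) q)^T
                            *m differential (read (height phi) a) q)
       = lambda (param a q) *: metric a q
     /\ tension (metric a) (metric b) (local_rep u a b) q
        = gradient (metric a) (read (height phi) a) q *m 'J (local_rep u a b) q.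
  split=> [[_] //|E]; split=> //.
  by split=> // a; exact: rot_smooth_height H a.
apply: (iff_trans einsteinE).
apply: (forall_iff) => a; apply: (forall_iff) => b.
apply: (forall_iff) => q; apply: (forall_iff) => r.
cbv zeta.
set x := param a q; set s := spart q; set h := height phi x.
set theta := angle f zeta beta s; set theta' := _^`()%classic s.
set w := Num.sqrt _; set sigma := parallel_radius f zeta beta s.
set J := 'J _ _; set dotN := metric_dot _; set tau := tension _ _ _ _.
have [aq [q' bq' uq']] := r.
have Uq := aq; rewrite (rot_domE H) in Uq; have [Is Vv] := Uq.
have [s0 s1] := Is.
have XP := rot_sphere_param H a.
have oI := @rot_open_interval _ t0 t1.
have [sf sz sb] := And3 (rot_warp_smooth H) (rot_zeta_smooth H) (rot_beta_smooth H).
have zw y : (t0 < y%:E)%E /\ (y%:E < t1)%E ->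
    zeta^`()%classic y = Num.sqrt (1 - angle f zeta beta y ^+ 2).
  by move=> [y0 y1]; exact: (rot_zeta_deriv H y0 y1).
have ang1 y : (t0 < y%:E)%E /\ (y%:E < t1)%E -> `|angle f zeta beta y| < 1.
  by move=> [y0 y1]; exact: angle1.
have w_gt0 : 0 < w by rewrite /w -(zw s Is); exact: (zeta_deriv_gt0 zw ang1).
have wE : zeta^`()%classic s = w by exact: zw.
have w2 : w ^+ 2 = 1 - theta ^+ 2.
  by rewrite -wE; exact: (zeta_deriv_sqr zw ang1 Is).
have hE : h = zeta s by exact: (height_param H aq).
have sigma_gt0 : 0 < sigma.
  by apply: radius_gt0; [exact: (rot_warp_pos H)|exact: (rot_beta_pos H)].
have f0_neq0 : f (zeta s) != 0 by rewrite gt_eqF // (rot_warp_pos H).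
pose P := pullback (metric b) (local_rep u a b) q.
pose g := sphere_metric (X a) (vpart q).
have bU : dom b (local_rep u a b q) by rewrite /local_rep -uq' paramK.
have Psym i j : P i j = P j i.
  suff PT : P^T = P by rewrite -[in LHS]PT mxE.
  by rewrite /P /pullback !trmx_mul trmxK Defs.metric_sym // mulmxA.
have g_gt0 i : 0 < g i i.
  by rewrite mxE; apply: eucl_dot_gt0; case: XP => _ _ _ /(_ _ Vv)[_ /(_ i)].
have g_orth i j : i != j -> g i j = 0.
  by move=> ij; rewrite mxE; case: XP => _ _ _ /(_ _ Vv)[_ _]; exact.
(* The normalizing factor of [frame_v]: it turns [du] of the frame vectors into entries of [P]
   divided by square roots of entries of [g]. Being nonzero, it does not affect which of these
   products vanish. *)
pose c i := (Num.sqrt (g i i))^-1.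
have c0 i : c i != 0 by rewrite invr_neq0 // gt_eqF // sqrtr_gt0.
have cc i : c i * c i = (g i i)^-1.
  by rewrite /c -invfM -expr2 sqr_sqrtr // ltW.
have frame_vE i : frame_v (X a) q i = c i *: delta_mx 0 (lift ord0 i).
  by rewrite /frame_v /c mxE.
have frame_sE : @frame_s R m = 1 *: delta_mx 0 ord0 by rewrite scale1r.
have dotN_scale k1 k2 i j : dotN ((k1 *: delta_mx 0 i : 'rV[R]_m.+1) *m J)
    ((k2 *: delta_mx 0 j : 'rV[R]_m.+1) *m J) = k1 * k2 * P i j.
  by rewrite /dotN metric_dot_mul delta_form.
have [R00 R0j Rj0 Rij] := rot_ricci H Uq.
have [H00 H0j Hj0 Hij] := rot_hessian H Uq.
have sg0 : sigma != 0 by rewrite gt_eqF.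
have w0 : w != 0 by rewrite gt_eqF.
have z2 := zeta_deriv2 oI sf sz sb zw ang1 Is.
have sg1 := derive_radius sf sz sb Is.
have sg2 := derive_radius2 oI sf sz sb Is.
rewrite wE in z2 sg1 sg2.
(* Here [beta] and [beta'] are eliminated through [beta = sigma / f] and [beta' = theta / f], to
   reach the form that the equation lemmas expect. *)
have {}sg1 : (parallel_radius f zeta beta)^`()%classic s =
    f^`()%classic (zeta s) / f (zeta s) * w * sigma + theta.
  rewrite sg1 /sigma /parallel_radius -/theta; congr (_ + _).
  by move: (f^`()%classic _) (beta s) => ? ?; field.
have {}sg2 : (parallel_radius f zeta beta)^`()^`()%classic s =
    f^`(2)%classic (zeta s) / f (zeta s) * w ^+ 2 * sigma
    + f^`()%classic (zeta s) / f (zeta s) * zeta^`(2)%classic s * sigma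
    + f^`()%classic (zeta s) / f (zeta s) * w * theta + theta'.
  rewrite sg2 /sigma /parallel_radius -/theta -/theta'; congr (_ + _ + _ + _).
  - by move: (f^`(2)%classic _) (beta s) => ? ?; field.
  - by move: (f^`()%classic _) (beta s) (zeta^`(2)%classic s) => ? ? ?; field.
  - rewrite /theta /angle -/s.
    by move: (f^`()%classic _) (beta^`()%classic s) => ? ?; field.
rewrite (rot_differential H Uq) (rot_gradient H Uq) (rot_metricE H Uq) wE.
rewrite -scalemxAl -/(@frame_s R m) hE.
rewrite (derive_ln_warp sf (rot_warp_pos H)) (derive2_ln_warp sf (rot_warp_pos H)).
(* The dimension [n] becomes [m + 1], matching [M + 1] in the equation lemmas with [M = m]. *)
rewrite -(@natr1 R m).
have radial := radial_equation m%:R (lambda x) alpha (mu x) w0 sg0 f0_neq0 w2 sg2 z2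
  (P ord0 ord0).
have spherical i := spherical_equation m%:R (lambda x) alpha w0 sg0 f0_neq0 w2 sg1 sg2 z2
  (P (lift ord0 i) (lift ord0 i)) (lt0r_neq0 (g_gt0 i)).
have alpha_neq0 : alpha != 0 by rewrite gt_eqF.
have entries := einstein_entries (mu x) (lambda x) w sigma alpha_neq0 Psym g_orth
  R00 R0j Rj0 Rij H00 H0j Hj0 Hij.
rewrite wE in entries.
(* Conditional on the tension equation, which belongs to both systems and is therefore at hand in
   each direction of the equivalence. *)
have tauE : tau = w *: (@frame_s R m *m J) ->
    dotN tau tau / (1 - theta ^+ 2) = P ord0 ord0.
  move=> ->; rewrite frame_sE scalemxAl scalerA mulr1 dotN_scale -w2 -expr2.
  by rewrite mulrAC divff ?mul1r // expf_neq0.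
have dot_vv i : dotN (frame_v (X a) q i *m J) (frame_v (X a) q i *m J) =
    P (lift ord0 i) (lift ord0 i) / g i i.
  by rewrite frame_vE dotN_scale cc mulrC.
have dot_vw i j : dotN (frame_v (X a) q i *m J) (frame_v (X a) q j *m J) =
    c i * c j * P (lift ord0 i) (lift ord0 j) by rewrite !frame_vE dotN_scale.
have dot_sv i : dotN (@frame_s R m *m J) (frame_v (X a) q i *m J) =
    c i * P ord0 (lift ord0 i) by rewrite frame_sE frame_vE dotN_scale mul1r.
split=> [[/entries[E00 Eii E0i Eij] Et]|[L00 Lii L0i Lij Et]].
  split=> // [|i|i|i j ij].
  - by rewrite (tauE Et); apply/radial.
  - by rewrite dot_vv; apply/spherical; have := Eii i; rewrite mulrDl.
  - by rewrite dot_sv E0i mulr0.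
  - by rewrite dot_vw Eij // mulr0.
split=> //; apply/entries; split=> [|i|i|i j ij].
- by apply/radial; rewrite -(tauE Et).
- by rewrite mulrDl; apply/spherical; rewrite -dot_vv.
- by apply: (mulfI (c0 i)); rewrite mulr0 -dot_sv.
- by apply: (mulfI (mulf_neq0 (c0 i) (c0 j))); rewrite mulr0 -dot_vw Lij.
Qed.
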